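(* Fix an arbitrary $N=1,2,\dots$. The series of entire functions $$\sum_{\lambda\in\mathbb{GT}_N}P'_N(\lambda\mid z,z',w,w')$$ converges in the domain $\mathcal{D}=\{(z,z',w,w')\in\mathbb{C}^4\mid\Re(z+z'+w+w')>-1\}$, uniformly on compact sets. Its sum is equal to $$S_N(z,z',w,w')=\prod_{i=1}^N\frac{\Gamma(z+z'+w+w'+i)}{\Gamma(z+w+i)\,\Gamma(z+w'+i)\,\Gamma(z'+w+i)\,\Gamma(z'+w'+i)\,\Gamma(i)}.$$
   Context: $\mathbb{GT}_N$ is the set of integer $N$-tuples $\lambda=(\lambda_1\ge\dots\ge\lambda_N)$. For $\lambda\in\mathbb{GT}_N$ put $\mathrm{Dim}_N(\lambda)=\prod_{1\le i<j\le N}\frac{\lambda_i-\lambda_j+j-i}{j-i}$ and, for $(z,z',w,w')\in\mathbb{C}^4$, $$P'_N(\lambda\mid z,z',w,w')=\mathrm{Dim}_N^2(\lambda)\prod_{i=1}^N\frac1{\Gamma(z-\lambda_i+i)\,\Gamma(z'-\lambda_i+i)\,\Gamma(w+N+1+\lambda_i-i)\,\Gamma(w'+N+1+\lambda_i-i)}.$$ Each $P'_N(\lambda\mid\cdot)$ is an entire function on $\mathbb{C}^4$ (with $1/\Gamma$ understood as an entire function). *)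

(* Defs.v *)
From HB Require Import structures.
From mathcomp Require Import all_boot all_order all_algebra finmap.
From mathcomp Require Import all_classical all_reals all_analysis.
From mathcomp Require Import complex.
From mathcomp.analysis.showcase Require Import summability.

Set Implicit Arguments.
Unset Strict Implicit.
Unset Printing Implicit Defensive.

Import Order.TTheory GRing.Theory Num.Theory.
Import numFieldNormedType.Exports.

Local Open Scope classical_set_scope.
Local Open Scope complex_scope.
Local Open Scope ring_scope.

(* The complex numbers, packaged as a [numClosedFieldType] so that they inherit
   the topology of the modulus that MathComp-Analysis attaches to such types;
   [R[i]] itself carries no topology. *)
Definition Cplx (R : realType) : numClosedFieldType := R[i].

Definition Cplx4 (R : realType) : topologicalType :=
  (Cplx R * Cplx R * Cplx R * Cplx R)%type.

Definition ofreal (R : realType) (x : R) : Cplx R := x%:C.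

Definition cexp (R : realType) (z : Cplx R) : Cplx R :=
  ofreal (expR (complex.Re z)) * (cos (complex.Im z) +i* sin (complex.Im z)).

(* n^z = exp (z log n); only meaningful for n > 0 *)
Definition natcpow (R : realType) (n : nat) (z : Cplx R) : Cplx R :=
  cexp (ofreal (ln n%:R) * z).

(* The entire function 1 / Gamma, by Gauss's formula
   Gamma(z) = lim_n  n! n^z / (z (z + 1) ... (z + n)).
   The limit is taken of the inverted expression, which has no poles. *)
Definition invGamma (R : realType) (z : Cplx R) : Cplx R :=
  lim ((\prod_(k < n.+1) (z + k%:R)) / (n`!%:R * natcpow n z) @[n --> \oo]).

(* Takes the junk value 0 at the poles 0, -1, -2, ... *)
Definition Gamma (R : realType) (z : Cplx R) : Cplx R := (invGamma z)^-1.

Definition GT (N : nat) : Type := {l : N.-tuple int | sorted >=%R l}.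

(* Coordinates are numbered from 0: [part l i] is lambda_(i+1). *)
Definition part (N : nat) (l : GT N) (i : 'I_N) : int := tnth (val l) i.

Definition Dim (R : realType) (N : nat) (l : GT N) : Cplx R :=
  \prod_(i < N) \prod_(j < N | (i < j)%N)
    ((part l i - part l j + j%:Z - i%:Z)%:~R / (j%:Z - i%:Z)%:~R).

Definition P' (R : realType) (N : nat) (l : GT N) (p : Cplx4 R) : Cplx R :=
  let: (z, z', w, w') := p in
  Dim R l ^+ 2 *
  \prod_(i < N)
    (invGamma (z - (part l i)%:~R + i.+1%:R) *
     invGamma (z' - (part l i)%:~R + i.+1%:R) *
     invGamma (w + N%:R + 1 + (part l i)%:~R - i.+1%:R) *
     invGamma (w' + N%:R + 1 + (part l i)%:~R - i.+1%:R)).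

Definition domD (R : realType) : set (Cplx4 R) :=
  [set p | let: (z, z', w, w') := p in
           -1 < complex.Re (z + z' + w + w' : R[i])].
Arguments domD : clear implicits.

Definition S_ (R : realType) (N : nat) (p : Cplx4 R) : Cplx R :=
  let: (z, z', w, w') := p in
  \prod_(1 <= i < N.+1)
    (Gamma (z + z' + w + w' + i%:R) *
     (invGamma (z + w + i%:R) * invGamma (z + w' + i%:R) *
      invGamma (z' + w + i%:R) * invGamma (z' + w' + i%:R) *
      invGamma i%:R)).

(* Main.v *)
(** With [x_i = lambda_i - i], the summand is, up to a constant, the squared
Vandermonde determinant of the [x_i] times [prod_i f (x_i)], where [f] is the
summand of Dougall's bilateral series 2H2.  One Vandermonde factor is written
with polynomials which, multiplied by [f], lower [z] by integers, and the other
with polynomials which lower [z'].  Andreief's identity then turns the sum over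
the [lambda] with all [|x_i| <= B] into an [N x N] determinant of partial sums
of Dougall series with shifted parameters.  As [B] grows, the entries
converge to quotients of Gamma values, and the limit is a Hankel determinant
[det (Gamma (A + i + j))], which factors.  Uniformity on compact sets follows
from the bound [f (l) = O (|l| ^ (- Re (z + z' + w + w') - 2N))].

Dougall's formula is proved without residues.  Both of its sides obey the same
contiguity relations, so their ratio does not change when [n] is added to all
four parameters.  After this shift the terms form a distribution concentrated on
[|l| << n], by a second moment computed from the same relations, and there they
are asymptotic to the terms for [z = z' = w = w' = 0], whose sum is known.  Hence
the ratio is [1]. *)

Require Import Defs.
From mathcomp Require Import all_boot all_order all_algebra finmap.
From mathcomp Require Import all_classical all_reals all_analysis.
From mathcomp Require Import complex.
From mathcomp.analysis.showcase Require Import summability.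
From mathcomp Require Import all_fingroup ring lra zify.
Import Order.TTheory GRing.Theory Num.Theory.
Import numFieldNormedType.Exports.
Local Open Scope classical_set_scope.
Local Open Scope ring_scope.

Set Implicit Arguments.
Unset Strict Implicit.
Unset Printing Implicit Defensive.

(** * Modulus, exponential and limits of complex numbers *)

Section ComplexNumbers.
Variable R : realType.
Local Notation C := (Cplx R).
Implicit Types (z w u : C) (x y e : R).

(** Write [a = z + z' + w + w']. The domain comes from counting exponents: the squared Vandermonde
    determinant costs [2 (N - 1)] powers of each [|x_i| + 1], so the decay [- Re a - 2N] becomes
    [- Re a - 2], which is summable when [Re a > -1]. The entries of the determinant ask for no
    more: lowering [z - 1] and [z' - 1] by at most [N - 1] each is compensated by [w + N] and
    [w' + N]. The two Vandermonde factors act on different parameters so that, in Dougall's value,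
    each reciprocal Gamma factor depends on the row alone or on the column alone; what couples them
    is a Hankel matrix. In Dougall's formula the obstacle is that the terms are complex, so a second
    moment gives no control of absolute values. For parameters [z, z^*, w, w^*] the terms are
    nonnegative, and by the inequality between arithmetic and geometric means two such families
    dominate the general term. The limit over boxes becomes a limit over all finite sets of
    signatures by domination, with a majorant that does not depend on the parameters. *)

Definition nrm (z : C) : R := ComplexField.Normc.normc z.

(** The norm on [Cplx R] takes its values in [Cplx R]; [nrm] moves estimates to the totally ordered
    field [R]. *)
Lemma normE z : `|z| = ofreal (nrm z). Proof. by []. Qed.

Lemma nrmM : {morph nrm : z w / z * w}.
Proof. exact: ComplexField.Normc.normcM. Qed.

Lemma nrmV z : nrm z^-1 = (nrm z)^-1.
Proof. exact: ComplexField.Normc.normcV. Qed.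

Lemma ofrealD : {morph @ofreal R : x y / x + y}.
Proof. by move=> x y; rewrite /ofreal rmorphD. Qed.
Lemma ofrealM : {morph @ofreal R : x y / x * y}.
Proof. by move=> x y; rewrite /ofreal rmorphM. Qed.
Lemma ofrealN x : ofreal (- x) = - ofreal x.
Proof. by rewrite /ofreal rmorphN. Qed.
Lemma ofreal_nat n : ofreal (n%:R : R) = n%:R.
Proof. by rewrite /ofreal rmorph_nat. Qed.
Lemma ofrealV x : ofreal x^-1 = (ofreal x)^-1.
Proof. by rewrite /ofreal fmorphV. Qed.

Lemma ler_ofreal x y : (ofreal x <= ofreal y) = (x <= y).
Proof. exact: lecR. Qed.
Lemma ltr_ofreal x y : (ofreal x < ofreal y) = (x < y).
Proof. exact: ltcR. Qed.

Lemma nrm_ge0 z : 0 <= nrm z.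
Proof. by rewrite -ler_ofreal -normE; exact: normr_ge0. Qed.

Lemma nrmD z w : nrm (z + w) <= nrm z + nrm w.
Proof. by rewrite -ler_ofreal ofrealD -!normE ler_normD. Qed.

Lemma ofreal_inj : injective (@ofreal R).
Proof. by move=> x y []. Qed.

Lemma nrmN z : nrm (- z) = nrm z.
Proof. by apply: ofreal_inj; rewrite -!normE normrN. Qed.

Lemma nrmB z w : nrm (z - w) = nrm (w - z).
Proof. by rewrite -nrmN opprB. Qed.

Lemma nrm0 : nrm 0 = 0 :> R.
Proof. by apply: ofreal_inj; rewrite -normE normr0. Qed.

Lemma nrm1 : nrm 1 = 1 :> R.
Proof. by apply: ofreal_inj; rewrite -normE normr1. Qed.

Lemma nrm_ofreal x : nrm (ofreal x) = `|x|.
Proof. by rewrite /nrm /= expr0n /= addr0 sqrtr_sqr. Qed.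

Lemma nrm_nat n : nrm (n%:R : C) = n%:R.
Proof. by rewrite -ofreal_nat nrm_ofreal normr_nat. Qed.

Lemma nrm_int (n : int) : nrm (n%:~R : C) = `|n%:~R|.
Proof. by rewrite -[n%:~R](rmorph_int (real_complex R)) nrm_ofreal. Qed.

Lemma nrmX z n : nrm (z ^+ n) = nrm z ^+ n.
Proof. by elim: n => [|n IH]; rewrite ?expr0 ?nrm1 // !exprS nrmM IH. Qed.

Lemma nrm_prod (I : Type) (r : seq I) (P : pred I) (F : I -> C) :
  nrm (\prod_(i <- r | P i) F i) = \prod_(i <- r | P i) nrm (F i).
Proof. exact: (big_morph _ nrmM nrm1). Qed.

Lemma nrm_sum (I : Type) (r : seq I) (P : pred I) (F : I -> C) :
  nrm (\sum_(i <- r | P i) F i) <= \sum_(i <- r | P i) nrm (F i).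
Proof.
elim/big_rec2: _ => [|i x y _ h]; first by rewrite nrm0.
by rewrite (le_trans (nrmD _ _)) // lerD2l.
Qed.

Lemma nrm_eq0 z : (nrm z == 0) = (z == 0).
Proof.
apply/eqP/eqP => [|->]; [exact: ComplexField.Normc.eq0_normc | exact: nrm0].
Qed.

Lemma nrm_gt0 z : (0 < nrm z) = (z != 0).
Proof. by rewrite lt_def nrm_eq0 nrm_ge0 andbT. Qed.

Lemma nrm_lerB z w : nrm z - nrm w <= nrm (z - w).
Proof. by rewrite lerBlDr (le_trans _ (nrmD _ _)) // subrK. Qed.

Lemma ler_Re_nrm z : `|complex.Re z| <= nrm z.
Proof.
case: z => a b /=; rewrite /nrm /= -sqrtr_sqr ler_sqrt ?lerDl ?sqr_ge0 //.
by rewrite addr_ge0 ?sqr_ge0.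
Qed.

Lemma ler_Im_nrm z : `|complex.Im z| <= nrm z.
Proof.
case: z => a b /=; rewrite /nrm /= -sqrtr_sqr ler_sqrt ?lerDr ?sqr_ge0 //.
by rewrite addr_ge0 ?sqr_ge0.
Qed.

Lemma nrm_ler_ReIm z : nrm z <= `|complex.Re z| + `|complex.Im z|.
Proof.
case: z => a b /=; rewrite /nrm /= -[leRHS]ger0_norm ?addr_ge0 //.
rewrite -sqrtr_sqr ler_sqrt ?sqr_ge0 // sqrrD !real_normK ?num_real //.
by rewrite lerD2r lerDl mulrn_wge0 // mulr_ge0.
Qed.

Lemma ReD z w : complex.Re (z + w) = complex.Re z + complex.Re w.
Proof. by case: z; case: w. Qed.
Lemma ImD z w : complex.Im (z + w) = complex.Im z + complex.Im w.
Proof. by case: z; case: w. Qed.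
Lemma ReN z : complex.Re (- z) = - complex.Re z. Proof. by case: z. Qed.
Lemma ImN z : complex.Im (- z) = - complex.Im z. Proof. by case: z. Qed.
Lemma Re_nat n : complex.Re (n%:R : C) = n%:R.
Proof. by rewrite -ofreal_nat. Qed.
Lemma Re1 : complex.Re (1 : C) = 1. Proof. by []. Qed.
Lemma sqr_nrm z : ofreal (nrm z ^+ 2) = z * z^*.
Proof. by rewrite expr2 ofrealM -normE -expr2 normCK. Qed.

Lemma conjE z : z^* = complex.Complex (complex.Re z) (- complex.Im z).
Proof. by case: z. Qed.

Lemma nrm_conj z : nrm z^* = nrm z.
Proof. by apply: ofreal_inj; rewrite -!normE norm_conjC. Qed.

Lemma conj_ofreal x : (ofreal x)^* = ofreal x.
Proof. by rewrite conjE /= oppr0. Qed.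

Lemma conjM z w : (z * w)^* = z^* * w^*. Proof. exact: rmorphM. Qed.
Lemma conjD z w : (z + w)^* = z^* + w^*. Proof. exact: rmorphD. Qed.

Lemma Re_conjc z : complex.Re z^* = complex.Re z. Proof. by case: z. Qed.

Lemma cexpD : {morph @cexp R : z w / z + w >-> z * w}.
Proof.
move=> [a b] [c d]; rewrite /cexp /= expRD cosD sinD ofrealM.
rewrite mulrACA; congr (_ * _).
by apply/eqP; rewrite eq_complex /=; apply/andP; split; apply/eqP; ring.
Qed.

Lemma cexp0 : cexp (0 : C) = 1.
Proof. by rewrite /cexp /= expR0 cos0 sin0 mul1r. Qed.

Lemma nrm_cexp z : nrm (cexp z) = expR (complex.Re z).
Proof.
rewrite /cexp nrmM nrm_ofreal ger0_norm ?expR_ge0 // /nrm /= cos2Dsin2.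
by rewrite sqrtr1 mulr1.
Qed.

Lemma cexp_neq0 z : cexp z != 0.
Proof. by rewrite -nrm_gt0 nrm_cexp expR_gt0. Qed.

Lemma cexpN z : cexp (- z) = (cexp z)^-1.
Proof. by apply: (mulfI (cexp_neq0 z)); rewrite -cexpD subrr cexp0 mulfV ?cexp_neq0. Qed.

Lemma cexp_ofreal x : cexp (ofreal x) = ofreal (expR x).
Proof. by rewrite /cexp /= cos0 sin0 mulr1. Qed.

Lemma conj_cexp z : (cexp z)^* = cexp z^*.
Proof.
case: z => a b; rewrite !conjE /cexp /= cosN sinN.
by apply/eqP; rewrite eq_complex /= !mul0r; apply/andP; split; apply/eqP; ring.
Qed.

(** Using [1 + t <= expR t] at [t = x] and at [t = - x] squeezes [expR x] between [1 + x] and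
    [1 / (1 - x)]. *)
Lemma expR_taylor1 x : `|x| <= 2^-1 -> `|expR x - 1 - x| <= 2 * x ^+ 2.
Proof.
move=> hx; have := expR_ge1Dx x; have := expR_ge1Dx (- x).
have := expR_gt0 x; rewrite expRN; set e := expR x => e0 h1 h2.
have h3 : (1 - x) * e <= 1 by rewrite -ler_pdivlMr // div1r.
rewrite ler_norml in hx; case/andP: hx => hx1 hx2.
by rewrite ler_norml; apply/andP; split; nra.
Qed.

Lemma sin_MVT0 y : 0 <= y ->
  exists2 c, 0 <= c <= y & sin y = cos c * y.
Proof.
move=> y0; have [|c c0y] := @MVT_segment R sin cos 0 y y0 (fun x _ => is_derive_sin x).
  by apply: continuous_subspaceT => x; exact: continuous_sin.
by rewrite sin0 !subr0 => ->; exists c => //; rewrite (itvP c0y).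
Qed.

Lemma cos_MVT0 y : 0 <= y ->
  exists2 c, 0 <= c <= y & cos y - 1 = - sin c * y.
Proof.
move=> y0.
have [|c c0y] := @MVT_segment R cos (fun x => - sin x) 0 y y0 (fun x _ => is_derive_cos x).
  by apply: continuous_subspaceT => x; exact: continuous_cos.
by rewrite cos0 !subr0 => ->; exists c => //; rewrite (itvP c0y).
Qed.

Lemma ler_norm_sin y : `|sin y| <= `|y|.
Proof.
wlog y0 : y / 0 <= y => [wl|].
  have [/wl//|yn] := leP 0 y.
  by rewrite -[leLHS]normrN -[leRHS]normrN -sinN wl // oppr_ge0 ltW.
have [c _ ->] := sin_MVT0 y0; rewrite normrM ler_piMl //.
by rewrite ler_norml cos_geN1 cos_le1.
Qed.

Lemma cos_taylor1 y : `|cos y - 1| <= y ^+ 2.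
Proof.
wlog y0 : y / 0 <= y => [wl|].
  have [/wl//|yn] := leP 0 y.
  by rewrite -cosN -sqrrN wl // oppr_ge0 ltW.
have [c /andP[c0 cy] ->] := cos_MVT0 y0.
rewrite normrM normrN (ger0_norm y0) expr2 ler_wpM2r //.
by rewrite (le_trans (ler_norm_sin _)) // ger0_norm.
Qed.

Lemma sin_taylor1 y : `|y| <= 1 -> `|sin y - y| <= y ^+ 2.
Proof.
wlog y0 : y / 0 <= y => [wl|].
  have [/wl//|yn] := leP 0 y.
  by rewrite -normrN -[in X in _ -> X]normrN opprD -sinN -sqrrN => h;
    apply: wl => //; rewrite oppr_ge0 ltW.
rewrite (ger0_norm y0) => y1.
have [c /andP[c0 cy] ->] := sin_MVT0 y0.
rewrite -{2}[y]mul1r -mulrBl normrM (ger0_norm y0) expr2 ler_wpM2r //.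
by rewrite (le_trans (cos_taylor1 _)) // (le_trans _ cy) // expr2; nra.
Qed.

(** For [u = x + i y] the real part of the remainder is at most [2 x^2 + 2 y^2] and the imaginary
    part at most [x^2 + 2 y^2], whence the constant 4. *)
Lemma cexp_taylor1 u : nrm u <= 2^-1 -> nrm (cexp u - 1 - u) <= 4 * nrm u ^+ 2.
Proof.
move=> hu; have hx := le_trans (ler_Re_nrm u) hu.
have hy := le_trans (ler_Im_nrm u) hu.
case: u hu hx hy => x y hu; rewrite [complex.Re _]/= [complex.Im _]/= => hx hy.
apply: (le_trans (nrm_ler_ReIm _)).
have -> : nrm (x +i* y)%C ^+ 2 = x ^+ 2 + y ^+ 2.
  by rewrite /nrm /= sqr_sqrtr // addr_ge0 ?sqr_ge0.
rewrite !ReD !ImD !ReN !ImN /cexp /= !mul0r subr0 addr0 oppr0 addr0.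
have ex := expR_taylor1 hx; have cy := cos_taylor1 y.
have sy := sin_taylor1 (le_trans hy (_ : 2^-1 <= 1)).
have e0 := expR_gt0 x.
have := ler_norm_sin y.
have {}sy : `|sin y - y| <= y ^+ 2 by apply: sy; lra.
move=> s1.
have ex1 : `|expR x - 1| <= 2 * `|x|.
  rewrite (_ : expR x - 1 = expR x - 1 - x + x); last by ring.
  apply: le_trans (ler_normD _ _) _; apply: le_trans (lerD ex (lexx _)) _.
  by have := normr_ge0 x; rewrite -(real_normK (num_real x)); nra.
have ex2 : expR x <= 2.
  by move: ex1; rewrite ler_norml => /andP[_]; lra.
have h1 : `|expR x * cos y - 1 - x| <= 2 * x ^+ 2 + 2 * y ^+ 2.
  rewrite (_ : _ - x = (expR x - 1 - x) + expR x * (cos y - 1)); last by ring.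
  apply: le_trans (ler_normD _ _) _; rewrite lerD // normrM (ger0_norm (ltW e0)).
  by apply: ler_pM => //; exact: ltW.
have h2 : `|expR x * sin y - y| <= x ^+ 2 + 2 * y ^+ 2.
  rewrite (_ : _ - y = (expR x - 1) * sin y + (sin y - y)); last by ring.
  apply: le_trans (ler_normD _ _) _.
  rewrite (_ : x ^+ 2 + _ = x ^+ 2 + y ^+ 2 + y ^+ 2); last by ring.
  rewrite lerD // normrM; apply: le_trans (ler_pM _ _ ex1 s1) _ => //.
  rewrite -(real_normK (num_real x)) -(real_normK (num_real y)).
  by have := sqr_ge0 (`|x| - `|y|); rewrite sqrrB; lra.
by rewrite /= in h1 h2 *; have := sqr_ge0 x; lra.
Qed.

Lemma cvg_nrmP (T : Type) (F : set_system T) {FF : Filter F} (f : T -> C) (l : C) :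
  f @ F --> l <-> (fun t => nrm (f t - l)) @ F --> (0 : R).
Proof.
split=> [/cvgrPdistC_lt h|/cvgr0Pnorm_lt h].
  apply/cvgr0Pnorm_lt => e e0.
  have e0' : 0 < ofreal e by rewrite ltr_ofreal.
  apply: filterS (h _ e0') => t; rewrite normE ltr_ofreal ger0_norm //.
  exact: nrm_ge0.
(* A positive element [a + i b] of [Cplx R] is a positive real: the order forces [b = 0]. *)
apply/cvgrPdistC_lt => -[a b]; rewrite ltcE /= => /andP[/eqP -> a0].
apply: filterS (h _ a0) => t.
by rewrite normE ltr_ofreal ger0_norm // nrm_ge0.
Qed.

Lemma cvg_ofreal (T : Type) (F : set_system T) {FF : Filter F} (f : T -> R) (l : R) :
  f @ F --> l -> ofreal (f t) @[t --> F] --> ofreal l.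
Proof.
move=> h; apply/cvg_nrmP; under eq_fun do rewrite -ofrealN -ofrealD nrm_ofreal.
by have := cvg_norm (cvgB h (cvg_cst l)); rewrite subrr normr0; exact.
Qed.

Lemma cvg_squeeze0 (T : Type) (F : set_system T) {FF : Filter F} (f g : T -> R) :
  (\forall t \near F, 0 <= f t <= g t) -> g @ F --> (0 : R) -> f @ F --> (0 : R).
Proof. by move=> h g0; apply: (squeeze_cvgr h _ g0); exact: cvg_cst. Qed.

Lemma cvgR_dist (T : Type) (F : set_system T) {FF : Filter F} (f g : T -> R) l :
  (\forall t \near F, `|f t - l| <= g t) -> g @ F --> (0 : R) -> f @ F --> l.
Proof.
move=> h g0; apply/cvgrPdistC_lt => e e0.
move/cvgr0_norm_lt: g0 => /(_ _ e0); apply: filterS2 h.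
move=> t h1 h2; by rewrite (le_lt_trans h1) // (le_lt_trans (ler_norm _) h2).
Qed.

Lemma cvgC_dist (T : Type) (F : set_system T) {FF : Filter F} (f : T -> C)
    (g : T -> R) l :
  (\forall t \near F, nrm (f t - l) <= g t) -> g @ F --> (0 : R) -> f @ F --> l.
Proof.
move=> h g0; apply/cvg_nrmP.
apply: (@cvg_squeeze0 T F FF _ g) g0; apply: filterS h => t ->.
by rewrite nrm_ge0.
Qed.

Lemma cvg_Re (T : Type) (F : set_system T) {FF : Filter F} (f : T -> C) (l : C) :
  f @ F --> l -> complex.Re (f t) @[t --> F] --> complex.Re l.
Proof.
move=> /cvg_nrmP h; apply: (@cvgR_dist T F FF _ _ _ _ h); apply: nearW => t.
by rewrite -ReN -ReD ler_Re_nrm.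
Qed.

Lemma ler_dist_nrm z w : `|nrm z - nrm w| <= nrm (z - w).
Proof. by rewrite ler_norml nrm_lerB andbT lerNl opprB nrmB nrm_lerB. Qed.

Lemma cvg_nrm (T : Type) (F : set_system T) {FF : Filter F} (f : T -> C) (l : C) :
  f @ F --> l -> nrm (f t) @[t --> F] --> nrm l.
Proof.
by move=> /cvg_nrmP h; apply: (@cvgR_dist T F FF _ _ _ _ h); apply: nearW => t; exact: ler_dist_nrm.
Qed.

Lemma cvg_conj (T : Type) (F : set_system T) {FF : Filter F} (f : T -> C) (l : C) :
  f @ F --> l -> (f t)^* @[t --> F] --> l^*.
Proof.
move=> /cvg_nrmP h; apply: (@cvgC_dist T F FF _ _ _ _ h); apply: nearW => t.
by rewrite -rmorphB nrm_conj.
Qed.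

Lemma nrm_cvg_le (u : nat -> C) l e m :
  u @ \oo --> l -> (forall n, (m <= n)%N -> nrm (u n) <= e) -> nrm l <= e.
Proof.
move=> /cvg_nrm ul h; rewrite -(cvg_lim _ ul) //; apply: limr_le.
  by apply: cvgP ul.
by exists m.
Qed.

Lemma is_cvg_cauchyR (u : nat -> R) :
  (forall e, 0 < e -> exists m, forall n, (m <= n)%N -> `|u n - u m| <= e) ->
  cvgn u.
Proof.
move=> h; apply/cauchy_cvgP/cauchy_exP => e e0.
have [m hm] := h (e / 2) (divr_gt0 e0 (ltr0n _ 2)).
exists (u m); exists m => // n /hm hn; rewrite /ball /= distrC.
by rewrite (le_lt_trans hn) // ltr_pdivrMr // ltr_pMr // ltr1n.
Qed.

Lemma is_cvg_cauchyC (u : nat -> C) :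
  (forall e, 0 < e -> exists m, forall n, (m <= n)%N -> nrm (u n - u m) <= e) ->
  cvgn u.
Proof.
move=> h.
have hR : cvgn (fun n => complex.Re (u n)).
  apply: is_cvg_cauchyR => e /h[m hm]; exists m => n /hm; apply: le_trans.
  by rewrite -ReN -ReD ler_Re_nrm.
have hI : cvgn (fun n => complex.Im (u n)).
  apply: is_cvg_cauchyR => e /h[m hm]; exists m => n /hm; apply: le_trans.
  by rewrite -ImN -ImD ler_Im_nrm.
have -> : u = (fun n => ofreal (complex.Re (u n)) +
                      ('i%C : C) * ofreal (complex.Im (u n))).
  by apply/funext => n; rewrite [LHS]complexE.
apply: cvgP; apply: cvgD; first exact: cvg_ofreal hR.
apply: cvgM; first exact: cvg_cst.
exact: cvg_ofreal hI.
Qed.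

Lemma natcpowD n z w : natcpow n (z + w) = natcpow n z * natcpow n w.
Proof. by rewrite /natcpow mulrDr cexpD. Qed.

Lemma natcpow0 n : natcpow n (0 : C) = 1.
Proof. by rewrite /natcpow mulr0 cexp0. Qed.

Lemma natcpow_neq0 n z : natcpow n z != 0.
Proof. exact: cexp_neq0. Qed.

Lemma natcpowN n z : natcpow n (- z) = (natcpow n z)^-1.
Proof. by rewrite /natcpow mulrN cexpN. Qed.

Lemma natcpow1 n : (0 < n)%N -> natcpow n (1 : C) = n%:R.
Proof.
by move=> n0; rewrite /natcpow mulr1 cexp_ofreal lnK ?posrE ?ltr0n // ofreal_nat.
Qed.

Lemma natcpow_nat n k : (0 < n)%N -> natcpow n (k%:R : C) = n%:R ^+ k.
Proof.
move=> n0; elim: k => [|k IH]; first by rewrite natcpow0 expr0.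
by rewrite -addn1 natrD natcpowD IH natcpow1 // exprD expr1.
Qed.

Lemma natcpowM m n z : (0 < m)%N -> (0 < n)%N ->
  natcpow (m * n) z = natcpow m z * natcpow n z.
Proof.
move=> m0 n0; rewrite /natcpow natrM lnM ?posrE ?ltr0n //.
by rewrite ofrealD mulrDl cexpD.
Qed.

Lemma Re_ofrealM x z : complex.Re (ofreal x * z) = x * complex.Re z.
Proof. by case: z => a b /=; rewrite mul0r subr0. Qed.

Lemma nrm_natcpow n z : (0 < n)%N -> nrm (natcpow n z) = n%:R `^ complex.Re z.
Proof.
move=> n0; rewrite /natcpow nrm_cexp Re_ofrealM.
by rewrite /powR pnatr_eq0 eqn0Ngt n0 mulrC.
Qed.

Lemma conj_natcpow n z : (natcpow n z)^* = natcpow n z^*.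
Proof.
by rewrite /natcpow conj_cexp conjM conj_ofreal.
Qed.

End ComplexNumbers.

(** * The function 1 / Gamma *)

Section InverseGamma.
Variable R : realType.
Local Notation C := (Cplx R).
Implicit Types (z w u : C) (x y e : R).

Definition poch z n : C := \prod_(k < n) (z + k%:R).

Lemma poch0 z : poch z 0 = 1. Proof. by rewrite /poch big_ord0. Qed.

Lemma pochS z n : poch z n.+1 = poch z n * (z + n%:R).
Proof. by rewrite /poch big_ord_recr. Qed.

Lemma pochSl z n : poch z n.+1 = z * poch (z + 1) n.
Proof.
rewrite /poch big_ord_recl addr0; congr (_ * _).
by apply: eq_bigr => i _; rewrite /= /bump /= natrD addrA.
Qed.

Definition gauss n z : C := poch z n.+1 / (n`!%:R * natcpow n z).

Definition gauss_ratio n z : C :=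
  (1 + z / n.+1%:R) * (natcpow n z / natcpow n.+1 z).

Lemma fact_neq0 n : n`!%:R != 0 :> C.
Proof. by rewrite pnatr_eq0 -lt0n fact_gt0. Qed.

Lemma gaussS n z : gauss n.+1 z = gauss n z * gauss_ratio n z.
Proof.
rewrite /gauss /gauss_ratio pochS factS natrM.
have h1 := fact_neq0 n; have h2 := natcpow_neq0 n z.
have h3 := natcpow_neq0 n.+1 z.
have h4 : 1 + n%:R != 0 :> C by rewrite addrC natr1 pnatr_eq0.
by rewrite -natr1; field; rewrite h1 h2 h3 addrC h4.
Qed.

Lemma ln_succ_bounds n : (0 < n)%N ->
  (n.+1%:R : R)^-1 <= ln (n.+1%:R : R) - ln (n%:R : R) <= n%:R^-1.
Proof.
move=> n0; have n0' : (0 : R) < n%:R by rewrite ltr0n.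
have n1' : (0 : R) < n.+1%:R by rewrite ltr0n.
have h x y : 0 < x -> 0 < y -> ln x - ln y <= x / y - 1.
  move=> x0 y0; rewrite -ln_div ?posrE //.
  have := expR_ge1Dx (ln (x / y)); rewrite lnK ?posrE ?divr_gt0 //; lra.
have := h _ _ n1' n0'; have := h _ _ n0' n1'.
have -> : n%:R / n.+1%:R - 1 = - (n.+1%:R)^-1 :> R.
  by rewrite -natr1; field; rewrite natr1 gt_eqF.
have -> : n.+1%:R / n%:R - 1 = n%:R^-1 :> R.
  by rewrite -natr1; field; rewrite gt_eqF.
by move=> ha hb; rewrite hb andbT -lerN2 opprB.
Qed.

(** With [l = ln (n + 1) - ln n] the ratio is [(1 + z / (n + 1)) exp (- l z)]. Since
    [1 / (n + 1) <= l <= 1 / n], the terms linear in [z] cancel up to order [1 / n^2]. The three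
    remaining pieces contribute [M], [M^2] and [8 M^2], hence the 10. *)
Lemma gauss_ratio_near1 (M n : nat) z : (0 < M)%N -> nrm z <= M%:R ->
  (2 * M <= n)%N ->
  nrm (gauss_ratio n z - 1) <= 10 * M%:R ^+ 2 / n%:R ^+ 2.
Proof.
move=> M0 zM Mn; have n0 : (0 < n)%N by apply: leq_trans Mn; rewrite muln_gt0.
have [n0' n1'] : (0 : R) < n%:R /\ (0 : R) < n.+1%:R by rewrite !ltr0n.
have M1 : (1 : R) <= M%:R by rewrite ler1n.
have Mn' : 2 * M%:R <= n%:R :> R by rewrite -natrM ler_nat.
have /andP[l1 l2] := ln_succ_bounds n0.
set l := ln _ - ln _ in l1 l2.
have z0 := nrm_ge0 z.
have l0 : 0 <= l by rewrite (le_trans _ l1) // invr_ge0 ltW.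
have e1 : natcpow n z / natcpow n.+1 z = cexp (- (ofreal l * z)).
  rewrite -natcpowN /natcpow -cexpD; congr cexp.
  by rewrite /l ofrealD ofrealN; ring.
clearbody l.
have nu : nrm (- (ofreal l * z)) = l * nrm z.
  by rewrite nrmN nrmM nrm_ofreal ger0_norm.
have lz : l * nrm z <= M%:R / n%:R by rewrite mulrC ler_pM.
have lz2 : l * nrm z <= 2^-1.
  by rewrite (le_trans lz) // ler_pdivrMr // ler_pdivlMl //.
have := @cexp_taylor1 _ (- (ofreal l * z)); rewrite nu => /(_ lz2).
rewrite /gauss_ratio e1; set E := _ - 1 - _ => hE.
have -> : (1 + z / n.+1%:R) * cexp (- (ofreal l * z)) - 1
   = z * ofreal (n.+1%:R^-1 - l) - ofreal (l / n.+1%:R) * z * z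
     + E * (1 + z / n.+1%:R).
  by rewrite /E ofrealD ofrealN ofrealM ofrealV ofreal_nat; ring.
have hi : (n.+1%:R)^-1 <= n%:R^-1 :> R by rewrite lef_pV2 ?posrE ?ler_nat.
have d : n%:R^-1 - n.+1%:R^-1 <= n%:R^-1 ^+ 2 :> R.
  have -> : n%:R^-1 - n.+1%:R^-1 = n%:R^-1 * n.+1%:R^-1 :> R.
    by rewrite -natr1; field; rewrite natr1 !gt_eqF.
  by rewrite expr2 ler_wpM2l // invr_ge0 ltW.
have b1 : nrm (z * ofreal (n.+1%:R^-1 - l)) <= M%:R / n%:R ^+ 2.
  rewrite nrmM nrm_ofreal ler_pM // -exprVn ler0_norm ?subr_le0 // opprB.
  by rewrite (le_trans _ d) // lerD2r.
have b2 : nrm (ofreal (l / n.+1%:R) * z * z) <= M%:R ^+ 2 / n%:R ^+ 2.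
  rewrite !nrmM nrm_ofreal normrM ger0_norm // normfV normr_nat.
  rewrite -expr_div_n expr2.
  rewrite (_ : _ * nrm z * nrm z = l * nrm z * (nrm z / n.+1%:R)); last by ring.
  by rewrite ler_pM ?mulr_ge0 ?invr_ge0 // ler_pM // invr_ge0.
have b3 : nrm (1 + z / n.+1%:R) <= 2.
  apply: le_trans (nrmD _ _) _; rewrite nrm1 nrmM nrmV nrm_nat.
  rewrite -[leRHS]/(1 + 1) lerD2l ler_pdivrMr // mul1r (le_trans zM) //.
  by rewrite -natr1; lra.
have b4 : nrm E <= 4 * (M%:R / n%:R) ^+ 2.
  by rewrite (le_trans hE) // ler_pM2l // ler_sqr ?nnegrE ?mulr_ge0 ?invr_ge0.
have b5 : nrm (E * (1 + z / n.+1%:R)) <= 8 * (M%:R ^+ 2 / n%:R ^+ 2).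
  rewrite nrmM -expr_div_n (_ : 8 * _ = 4 * (M%:R / n%:R) ^+ 2 * 2); last by ring.
  by rewrite ler_pM ?nrm_ge0.
apply: le_trans (nrmD _ _) _; apply: le_trans (lerD (nrmD _ _) b5) _.
rewrite nrmN; apply: le_trans (lerD (lerD b1 b2) (lexx _)) _.
have : M%:R / n%:R ^+ 2 <= M%:R ^+ 2 / n%:R ^+ 2 :> R.
  by rewrite ler_pM2r ?invr_gt0 ?exprn_gt0 // expr2 ler_peMr.
lra.
Qed.

(* Telescoping [1/n^2 <= 1/(n-1) - 1/n] makes the tail of the product small. *)
Lemma gauss_near (M k n : nat) z : (0 < M)%N -> nrm z <= M%:R ->
  (20 * M ^ 2 <= k)%N -> (k < n)%N ->
  nrm (gauss n z - gauss k.+1 z) <= 20 * M%:R ^+ 2 / k%:R * nrm (gauss k.+1 z).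
Proof.
move=> M0 zM Mk kn.
have k0 : (0 < k)%N by apply: leq_trans Mk; rewrite muln_gt0 expn_gt0 M0.
have Mk' : 20 * M%:R ^+ 2 <= k%:R :> R by rewrite -natrX -natrM ler_nat.
have k0' : (0 : R) < k%:R by rewrite ltr0n.
set G := nrm (gauss k.+1 z); have G0 : 0 <= G by exact: nrm_ge0.
suff h j : nrm (gauss (k.+1 + j) z - gauss k.+1 z)
            <= 20 * M%:R ^+ 2 * (k%:R^-1 - (k + j)%:R^-1) * G.
  rewrite -(subnKC kn) (le_trans (h _)) // ler_wpM2r // ler_wpM2l //.
  by rewrite lerBlDr lerDl invr_ge0.
elim: j => [|j IH]; first by rewrite !addn0 !subrr nrm0 mulr0 mul0r.
set n' := (k.+1 + j)%N; rewrite addnS -/n' gaussS.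
have -> : gauss n' z * gauss_ratio n' z - gauss k.+1 z
  = gauss n' z * (gauss_ratio n' z - 1) + (gauss n' z - gauss k.+1 z) by ring.
have nn : n'%:R = (k + j)%:R + 1 :> R by rewrite natr1 /n' addSn.
have kj0 : (0 : R) < (k + j)%:R by rewrite ltr0n addn_gt0 k0.
have g2 : nrm (gauss n' z) <= 2 * G.
  rewrite -[gauss n' z](subrK (gauss k.+1 z)) (le_trans (nrmD _ _)) //.
  rewrite mulrDl mul1r lerD2r (le_trans IH) // ler_piMl //.
  rewrite mulrBr; have : 20 * M%:R ^+ 2 * k%:R^-1 <= 1 :> R.
    by rewrite ler_pdivrMr // mul1r.
  have : 0 <= 20 * M%:R ^+ 2 * (k + j)%:R^-1 :> R.
    by rewrite !mulr_ge0 ?exprn_ge0 ?invr_ge0.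
  lra.
have r1 : nrm (gauss_ratio n' z - 1) <= 10 * M%:R ^+ 2 / n'%:R ^+ 2.
  apply: gauss_ratio_near1 => //; rewrite /n' addSn leqW //.
  apply: leq_trans (leq_addr _ _); apply: leq_trans Mk.
  by rewrite -mulnn; nia.
apply: le_trans (nrmD _ _) _; rewrite nrmM.
apply: le_trans (lerD (ler_pM (nrm_ge0 _) (nrm_ge0 _) g2 r1) IH) _.
have t : n'%:R ^- 2 <= (k + j)%:R^-1 - n'%:R^-1 :> R.
  rewrite nn; move: ((k + j)%:R : R) kj0 => x x0.
  have x1 : 0 < x + 1 by rewrite ltr_wpDl // ltW.
  have -> : x^-1 - (x + 1)^-1 = x^-1 * (x + 1)^-1 by field; rewrite !gt_eqF.
  rewrite expr2 invfM ler_wpM2r ?invr_ge0 ?ltW // ltf_pV2 ?posrE //.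
  by rewrite ltrDl.
have -> : (k + j.+1)%:R = n'%:R :> R by rewrite /n' addSn addnS.
have M2 : 0 <= 20 * M%:R ^+ 2 * G by rewrite !mulr_ge0 ?exprn_ge0.
have := ler_wpM2l M2 t.
rewrite mulrBr => h.
rewrite [leLHS](_ : _ = 20 * M%:R ^+ 2 * G * n'%:R ^- 2
    + 20 * M%:R ^+ 2 * (k%:R^-1 - (k + j)%:R^-1) * G); last by ring.
lra.
Qed.

Lemma nat_bound z : exists2 M, (0 < M)%N & nrm z <= M%:R.
Proof.
have /ltW := archi_boundP (nrm_ge0 z); set m := Num.bound _ => h.
by exists m.+1 => //; rewrite (le_trans h) // ler_nat.
Qed.

Lemma is_cvg_gauss z : cvgn (fun n => gauss n z).
Proof.
have [M M0 zM] := nat_bound z.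
set k0 := (20 * M ^ 2)%N.
have k00 : (0 < k0)%N by rewrite muln_gt0 expn_gt0 M0.
set G := nrm (gauss k0.+1 z).
(* [gauss_near] bounds relative errors; a Cauchy estimate also needs this bound on the terms
   themselves. *)
have gb n : (k0 < n)%N -> nrm (gauss n z) <= 2 * G.
  move=> h; rewrite -[gauss n z](subrK (gauss k0.+1 z)) (le_trans (nrmD _ _)) //.
  rewrite mulrDl mul1r lerD2r (le_trans (gauss_near M0 zM (leqnn _) h)) //.
  rewrite ler_piMl ?nrm_ge0 // ler_pdivrMr ?ltr0n // mul1r.
  by rewrite /k0 natrM natrX.
apply: is_cvg_cauchyC => e e0.
have [k1 hk1] : exists k1 : nat, 20 * M%:R ^+ 2 * (2 * G) / e <= k1%:R.
  have h : 0 <= 20 * M%:R ^+ 2 * (2 * G) / e.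
    by rewrite divr_ge0 ?mulr_ge0 ?exprn_ge0 ?nrm_ge0 // ltW.
  by have /ltW := archi_boundP h; set m := Num.bound _ => {}h; exists m.
set k := (k0 + k1)%N; have kk0 : (k0 <= k)%N by exact: leq_addr.
exists k.+1 => n kn; apply: le_trans (gauss_near M0 zM kk0 kn) _.
have kp : (0 : R) < k%:R by rewrite ltr0n addn_gt0 k00.
apply: (@le_trans _ _ (20 * M%:R ^+ 2 / k%:R * (2 * G))).
  by rewrite ler_wpM2l // ?gb // ?ltnS ?leq_addr.
rewrite mulrAC ler_pdivrMr // [e * _]mulrC -ler_pdivrMr //.
by rewrite (le_trans hk1) // ler_nat leq_addl.
Qed.

Lemma cvg_invGamma z : (fun n => gauss n z) @ \oo --> invGamma z.
Proof. exact: is_cvg_gauss. Qed.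

Lemma invGamma_near (M k : nat) z : (0 < M)%N -> nrm z <= M%:R ->
  (20 * M ^ 2 <= k)%N ->
  nrm (invGamma z - gauss k.+1 z) <= 20 * M%:R ^+ 2 / k%:R * nrm (gauss k.+1 z).
Proof.
move=> M0 zM Mk; apply: (@nrm_cvg_le _ (fun n => gauss n z - gauss k.+1 z) _ _ k.+1).
  by apply: cvgB; [exact: cvg_invGamma | exact: cvg_cst].
by move=> n kn; exact: gauss_near.
Qed.

Lemma invGamma_eq z l : (fun n => gauss n z) @ \oo --> l -> invGamma z = l.
Proof. by move=> h; exact: (cvg_lim _ h). Qed.

Lemma cvg_comp_succ (V : ptopologicalType) (v : nat -> V) (l : V) :
  (v n @[n --> \oo] --> l) = (v n.+1 @[n --> \oo] --> l).
Proof. exact/esym/(cvg_shiftS v (nbhs l)). Qed.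

Lemma cvg_invSn : (n.+1%:R : C)^-1 @[n --> \oo] --> (0 : C).
Proof.
apply: (@cvgC_dist R _ _ _ _ (fun n => (n.+1%:R : R)^-1)); last exact: cvg_harmonic.
by apply: nearW => n; rewrite subr0 nrmV nrm_nat.
Qed.

Lemma invGammaS z : invGamma z = z * invGamma (z + 1).
Proof.
have h1 : (fun n => z * gauss n.+1 (z + 1)) @ \oo --> z * invGamma (z + 1).
  apply: cvgM; first exact: cvg_cst.
  by rewrite -(cvg_comp_succ (fun n => gauss n (z + 1))); exact: cvg_invGamma.
(* For [m = n + 1] one has [z * gauss m (z + 1) = gauss m z * (1 + (z + 1) / m)]. The index 0 is
   avoided because [natcpow 0] is meaningless. *)
have h2 : (fun n => gauss n.+1 z + gauss n.+1 z * (z + 1) * n.+1%:R^-1) @ \oo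
    --> invGamma z.
  rewrite -[X in _ --> X]addr0 -[in X in _ --> X](mulr0 (invGamma z * (z + 1))).
  have g : (fun n => gauss n.+1 z) @ \oo --> invGamma z.
    by rewrite -(cvg_comp_succ (fun n => gauss n z)); exact: cvg_invGamma.
  apply: cvgD; first exact: g.
  apply: cvgM; first by apply: cvgM; [exact: g | exact: cvg_cst].
  exact: cvg_invSn.
apply: cvg_unique h2 _ => //; apply: cvg_trans h1; apply: near_eq_cvg.
apply: nearW => n; rewrite /gauss natcpowD natcpow1 // mulrA -pochSl pochS.
have f0 := fact_neq0 n.+1; have p0 := natcpow_neq0 n.+1 z.
have n0 : 1 + n%:R != 0 :> C by rewrite -[1]/(1%:R) -natrD pnatr_eq0.
by rewrite -[n.+2%:R]natr1; field; rewrite f0 p0 n0.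
Qed.

Lemma poch_invGamma z n : invGamma z = poch z n * invGamma (z + n%:R).
Proof.
elim: n => [|n IH]; first by rewrite poch0 mul1r addr0.
by rewrite IH [invGamma (z + n%:R)]invGammaS pochS mulrA -addrA natr1.
Qed.

Lemma invGamma1 : invGamma (1 : C) = 1.
Proof.
apply: invGamma_eq.
have h : (fun n => (1 : C) + n.+1%:R^-1) @ \oo --> (1 : C).
  rewrite -[X in _ --> X]addr0; apply: cvgD; first exact: cvg_cst.
  exact: cvg_invSn.
rewrite cvg_comp_succ; apply: cvg_trans h; apply: near_eq_cvg.
apply: nearW => n; rewrite /gauss natcpow1 //.
have -> : poch 1 n.+2 = n.+2`!%:R.
  rewrite /poch fact_prod natr_prod big_add1 big_mkord.
  by apply: eq_bigr => i _; rewrite -[1]/(1%:R) -natrD.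
have f0 := fact_neq0 n.+1; rewrite factS natrM -[n.+2%:R]natr1.
have n0 : 1 + n%:R != 0 :> C by rewrite -[1]/(1%:R) -natrD pnatr_eq0.
by field; rewrite f0 n0.
Qed.

Lemma invGamma_nat n : invGamma (n.+1%:R : C) = (n`!%:R)^-1.
Proof.
elim: n => [|n IH]; first by rewrite invGamma1 fact0 invr1.
move: IH; rewrite invGammaS natr1 => IH.
have n0 : n.+1%:R != 0 :> C by rewrite pnatr_eq0.
by apply: (mulfI n0); rewrite IH factS natrM invfM mulrA mulfV // mul1r.
Qed.

Lemma invGamma_opp_nat n : invGamma (- n%:R : C) = 0.
Proof.
elim: n => [|n IH]; rewrite invGammaS ?oppr0 ?mul0r //.
by rewrite -natr1 opprD addrNK IH mulr0.
Qed.

Lemma conjV z : (z^-1)^* = (z^*)^-1. Proof. exact: fmorphV. Qed.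

Lemma conj_nat n : (n%:R : C)^* = n%:R.
Proof. by rewrite -ofreal_nat conj_ofreal. Qed.

Lemma conj_invGamma z : (invGamma z)^* = invGamma z^*.
Proof.
have h : (fun n => (gauss n z)^*) @ \oo --> (invGamma z)^*.
  by apply: cvg_conj; exact: cvg_invGamma.
apply/esym/invGamma_eq; apply: cvg_trans h; apply: near_eq_cvg; apply: nearW => n.
rewrite /gauss conjM conjV conjM conj_natcpow conj_nat; congr (_ / _).
rewrite /poch (big_morph (fun u : C => u^*) (@conjM R) (conj_nat 1)).
by apply: eq_bigr => i _; rewrite conjD conj_nat.
Qed.

Lemma poch_neq0 z n : (forall k, (k < n)%N -> z + k%:R != 0) -> poch z n != 0.
Proof.
by move=> h; apply/prodf_neq0 => i _; exact: h.
Qed.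

Lemma gauss_eq0 n z : (gauss n z == 0) = (poch z n.+1 == 0).
Proof.
by rewrite /gauss mulf_eq0 invr_eq0 mulf_eq0 (negPf (fact_neq0 n))
  (negPf (natcpow_neq0 n z)) !orbF.
Qed.

(** Doubling the threshold of [invGamma_near] brings the relative error down to 1/2. Hence
    [invGamma z] can vanish only together with a finite product [poch], which is how zeros are
    excluded below. *)
Lemma gauss_half (M k : nat) z : (0 < M)%N -> nrm z <= M%:R ->
  (40 * M ^ 2 <= k)%N ->
  2^-1 * nrm (gauss k.+1 z) <= nrm (invGamma z) <= 2 * nrm (gauss k.+1 z).
Proof.
move=> M0 zM Mk; have Mk' : (20 * M ^ 2 <= k)%N by apply: leq_trans Mk; rewrite leq_mul.
have k0 : (0 : R) < k%:R.
  by rewrite ltr0n; apply: leq_trans Mk; rewrite muln_gt0 expn_gt0 M0.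
have h := invGamma_near M0 zM Mk'.
have {}h : nrm (invGamma z - gauss k.+1 z) <= 2^-1 * nrm (gauss k.+1 z).
  rewrite (le_trans h) // ler_wpM2r ?nrm_ge0 // ler_pdivrMr // -ler_pdivrMl ?invr_gt0 //.
  by rewrite invrK mulrA -natrX -!natrM ler_nat.
have := le_trans (ler_dist_nrm _ _) h; rewrite ler_norml => /andP[h1 h2].
by have g0 := nrm_ge0 (gauss k.+1 z); apply/andP; split; lra.
Qed.

Lemma invGamma_neq0 z : (forall k, z + k%:R != 0) -> invGamma z != 0.
Proof.
move=> h; have [M M0 zM] := nat_bound z.
have /andP[h1 _] := gauss_half M0 zM (leqnn _).
rewrite -nrm_gt0; apply: lt_le_trans h1; rewrite mulr_gt0 ?invr_gt0 //.
by rewrite nrm_gt0 gauss_eq0 poch_neq0.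
Qed.

Lemma Re_gt0_addn_neq0 z k : 0 < complex.Re z -> z + k%:R != 0.
Proof.
move=> z0; apply/eqP => /(congr1 (@complex.Re R)) /eqP; rewrite ReD Re_nat /=.
by rewrite gt_eqF // ltr_wpDr.
Qed.

Lemma invGamma_Re_gt0 z : 0 < complex.Re z -> invGamma z != 0.
Proof. by move=> z0; apply: invGamma_neq0 => k; exact: Re_gt0_addn_neq0. Qed.

(* Stirling-type normalisation: [1 / Gamma (z + k + 1) ~ 1 / (k! k^z)]. *)
Definition stirling_ratio k z : C :=
  invGamma (z + k.+1%:R) * k`!%:R * natcpow k z.

Lemma gauss_stirling_ratio k z : gauss k z * stirling_ratio k z = invGamma z.
Proof.
rewrite (poch_invGamma z k.+1) /gauss /stirling_ratio.
by field; rewrite fact_neq0 natcpow_neq0.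
Qed.

Lemma cvg_stirling_ratio z : 0 < complex.Re z ->
  stirling_ratio k z @[k --> \oo] --> (1 : C).
Proof.
move=> z0; have i0 := invGamma_Re_gt0 z0.
have h : (fun k => invGamma z / gauss k z) @ \oo --> invGamma z / invGamma z.
  by apply: cvgM; [exact: cvg_cst | apply: cvgV => //; exact: cvg_invGamma].
rewrite -(mulfV i0); apply: cvg_trans h; apply: near_eq_cvg; apply: nearW => k /=.
rewrite -(gauss_stirling_ratio k) mulrAC mulfV ?mul1r //.
by rewrite gauss_eq0 poch_neq0 // => j _; exact: Re_gt0_addn_neq0.
Qed.

Lemma stirling_ratio_le2 (M k : nat) z : (0 < M)%N -> nrm z <= M%:R ->
  (40 * M ^ 2 <= k)%N -> nrm (stirling_ratio k.+1 z) <= 2.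
Proof.
move=> M0 zM Mk; have [g0|g0] := eqVneq (gauss k.+1 z) 0; last first.
  have /andP[_] := gauss_half M0 zM Mk.
  rewrite -(gauss_stirling_ratio k.+1) nrmM mulrC ler_pM2r //.
  by rewrite nrm_gt0.
(* At [z = - j] the quotient of [invGamma z] by [gauss k.+1 z] is 0/0. There the ratio is the
   falling factorial of [k + 1] of length [j] divided by [(k + 1)^j], so at most 1. *)
move/eqP: g0; rewrite gauss_eq0 => /eqP/eqP/prodf_eq0[j _].
rewrite addr_eq0 => /eqP zE; rewrite zE /stirling_ratio.
have jk : (j <= k.+1)%N by rewrite -ltnS.
have -> : - j%:R + k.+2%:R = (k.+1 - j).+1%:R :> C.
  by apply/eqP; rewrite addrC subr_eq -natrD addSn subnK.
rewrite invGamma_nat natcpowN natcpow_nat // !nrmM !nrmV nrmX !nrm_nat.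
rewrite -(ffact_fact jk) natrM.
have f0 : ((k.+1 - j)`!%:R : R) != 0 by rewrite pnatr_eq0 -lt0n fact_gt0.
rewrite [X in X / _]mulrCA mulVf // mulr1 ler_pdivrMr ?exprn_gt0 ?ltr0n //.
rewrite (@le_trans _ _ (k.+1%:R ^+ j)) //; last first.
  by rewrite ler_peMl ?exprn_ge0 // ler1n.
rewrite -natrX ler_nat ffact_prod -[X in (_ <= _ ^ X)%N]card_ord -prod_nat_const.
by apply: leq_prod => i _; exact: leq_subr.
Qed.

End InverseGamma.

(** * Growth of 1 / Gamma along integer shifts, uniformly on bounded sets *)

Section GammaBounds.
Variable R : realType.
Local Notation C := (Cplx R).
Implicit Types (z w u : C) (x y e : R).

Lemma powR_comparable (a b c e m : R) : 0 < a -> 0 < b -> a <= c * b ->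
  b <= c * a -> `|e| <= m -> a `^ e <= c `^ m * b `^ e.
Proof.
move=> a0 b0 ab ba em.
have c0 : 0 < c by rewrite -(pmulr_lgt0 _ b0) (lt_le_trans a0).
rewrite /powR !gt_eqF // -expRD ler_expR -lerBlDr -mulrBr.
apply: le_trans (ler_norm _) _; rewrite normrM ler_pM //.
have l1 : ln a <= ln c + ln b by rewrite -lnM ?posrE // ler_ln ?posrE ?mulr_gt0.
have l2 : ln b <= ln c + ln a by rewrite -lnM ?posrE // ler_ln ?posrE ?mulr_gt0.
by rewrite ler_norml; apply/andP; split; lra.
Qed.

Lemma ler_powR_abs (a e m : R) : 1 <= a -> `|e| <= m -> a `^ (- m) <= a `^ e <= a `^ m.
Proof.
by move=> a1; rewrite ler_norml => /andP[h1 h2]; rewrite !ler_powR.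
Qed.

Lemma gauss_crude (M n : nat) z : nrm z <= M%:R -> (0 < n)%N ->
  nrm (gauss n z) <= (M + n)%:R ^+ n.+1 * n%:R `^ M%:R.
Proof.
move=> zM n0; rewrite /gauss nrmM nrmV nrmM nrm_nat nrm_natcpow // invfM.
have hp : nrm (poch z n.+1) <= (M + n)%:R ^+ n.+1.
  rewrite /poch nrm_prod -[n.+1 in leRHS]card_ord -prodr_const.
  apply: ler_prod => i _; rewrite nrm_ge0 /=; apply: le_trans (nrmD _ _) _.
  by rewrite nrm_nat natrD lerD // ler_nat -ltnS.
have f0 : (0 : R) < n`!%:R by rewrite ltr0n fact_gt0.
rewrite ler_pM ?nrm_ge0 ?mulr_ge0 ?invr_ge0 ?powR_ge0 ?ler0n //.
rewrite -powRN -[leRHS]mul1r ler_pM ?invr_ge0 ?powR_ge0 ?ler0n //.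
  by rewrite invf_le1 // ler1n fact_gt0.
apply: ler_powR; first by rewrite ler1n.
by have := le_trans (ler_Re_nrm z) zM; rewrite ler_norml; lra.
Qed.

(** Past the threshold [gauss_near] applies; the finitely many earlier indices are covered by
    [gauss_crude]. *)
Lemma gauss_bounded (M : nat) : (0 < M)%N ->
  exists2 B : R, 0 <= B & forall n z, nrm z <= M%:R -> (0 < n)%N ->
    nrm (gauss n z) <= B.
Proof.
move=> M0; set k := (20 * M ^ 2)%N.
have k0 : (0 < k)%N by rewrite muln_gt0 expn_gt0 M0.
pose B : R := (M + k.+1)%:R ^+ k.+2 * k.+1%:R `^ M%:R.
have B0 : 0 <= B by rewrite mulr_ge0 ?exprn_ge0 ?powR_ge0.
have small n z : nrm z <= M%:R -> (0 < n <= k.+1)%N -> nrm (gauss n z) <= B.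
  move=> zM /andP[n0 nk]; apply: le_trans (gauss_crude zM n0) _.
  rewrite ler_pM ?exprn_ge0 ?powR_ge0 //; last first.
    by rewrite ge0_ler_powR ?nnegrE ?ler_nat.
  apply: (@le_trans _ _ ((M + k.+1)%:R ^+ n.+1)).
    by rewrite lerXn2r ?nnegrE // ler_nat leq_add2l.
  by rewrite ler_weXn2l // ?ler1n ?addn_gt0 ?M0 ?ltnS.
exists (2 * B) => [|n z zM n0]; first by rewrite mulr_ge0.
have [nk|kn] := leqP n k.+1.
  by rewrite (le_trans (small _ _ zM _)) ?n0 // ler_peMl // ler1n.
have gk : nrm (gauss k.+1 z) <= B by rewrite small ?leqnn.
rewrite -[gauss n z](subrK (gauss k.+1 z)) (le_trans (nrmD _ _)) //.
rewrite mulrDl mul1r lerD // (le_trans _ gk) //.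
apply: le_trans (gauss_near M0 zM (leqnn _) (ltnW kn)) _.
rewrite ler_piMl ?nrm_ge0 // ler_pdivrMr ?ltr0n // mul1r.
by rewrite -/k /k natrM natrX.
Qed.

Lemma invGamma_bounded (M : nat) : (0 < M)%N ->
  exists2 B : R, 0 <= B & forall z, nrm z <= M%:R -> nrm (invGamma z) <= B.
Proof.
move=> /gauss_bounded[B B0 h]; exists B => // z zM.
by apply: nrm_cvg_le (@cvg_invGamma _ z) _ => n n0; apply: h => //; exact: n0.
Qed.

Lemma poch_bounded (M : nat) : (0 < M)%N ->
  exists2 B : R, 0 <= B & forall l z, nrm z <= M%:R ->
    nrm (poch z l) <= B * l`!%:R * l.+1%:R `^ (complex.Re z - 1).
Proof.
move=> M0; have [B B0 h] := gauss_bounded M0.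
have M1 : (1 : R) <= M%:R by rewrite ler1n.
pose B1 : R := M%:R * 2 `^ (M%:R + 1).
pose B2 : R := B * 3 `^ M%:R * 2.
have B10 : 0 <= B1 by rewrite mulr_ge0 ?powR_ge0.
have B20 : 0 <= B2 by rewrite !mulr_ge0 ?powR_ge0.
exists (1 + B1 + B2) => [|l z zM]; first by rewrite !addr_ge0.
have xM := le_trans (ler_Re_nrm z) zM.
set x := complex.Re z in xM *.
(* [poch z l] is read off [gauss] at index [l - 1], which has to be positive; hence [l = 0] and
   [l = 1] are treated apart. *)
case: l => [|[|l]].
- by rewrite poch0 nrm1 fact0 powR1 !mulr1 -addrA lerDl addr_ge0.
- rewrite pochS poch0 mul1r addr0 factS fact0 mulr1.
  have x1 : `|x - 1| <= M%:R + 1 by rewrite (le_trans (ler_normB _ _)) // normr1 lerD2r.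
  have /andP[p _] := @ler_powR_abs 2 (x - 1) (M%:R + 1) (ler1n _ 2) x1.
  rewrite (@le_trans _ _ (B1 * 2 `^ (x - 1))) //; last first.
    by rewrite ler_wpM2r ?powR_ge0 // addrAC lerDr addr_ge0.
  rewrite (le_trans zM) // (@le_trans _ _ (B1 * 2 `^ (- (M%:R + 1)))) //; last first.
    by rewrite ler_wpM2l.
  by rewrite /B1 -mulrA -powRD ?subrr ?powRr0 ?mulr1 // pnatr_eq0 implybT.
rewrite (@le_trans _ _ (B2 * l.+2`!%:R * l.+3%:R `^ (x - 1))) //; last first.
  by rewrite ler_wpM2r ?powR_ge0 // ler_wpM2r // lerDr addr_ge0.
have := h l.+1 z zM isT; rewrite /gauss nrmM nrmV nrmM nrm_nat nrm_natcpow //.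
rewrite ler_pdivrMr; last by rewrite mulr_gt0 ?ltr0n ?fact_gt0 // powR_gt0 ltr0n.
move=> /le_trans; apply.
have l3 : (l.+1%:R : R) `^ x <= 3 `^ M%:R * l.+3%:R `^ x.
  by apply: powR_comparable; rewrite ?ltr0n // -natrM ler_nat; lia.
have l30 : (0 : R) < l.+3%:R by rewrite ltr0n.
have -> : l.+3%:R `^ (x - 1) = l.+3%:R `^ x / l.+3%:R :> R.
  rewrite powRD; last by rewrite (gt_eqF l30) implybT.
  by rewrite powRN powRr1 // ltW.
rewrite (@le_trans _ _ (B * l.+1`!%:R * (3 `^ M%:R * l.+3%:R `^ x))) //.
  by rewrite -[leRHS]mulrA ler_wpM2l // ler_wpM2l.
rewrite /B2 [l.+2`!]factS natrM.
have -> : B * 3 `^ M%:R * 2 * (l.+2%:R * l.+1`!%:R) * (l.+3%:R `^ x / l.+3%:R)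
   = B * l.+1`!%:R * (3 `^ M%:R * l.+3%:R `^ x) * (2 * l.+2%:R / l.+3%:R) by ring.
rewrite ler_peMr //.
  by rewrite !mulr_ge0 ?powR_ge0.
by rewrite ler_pdivlMr // mul1r -natrM ler_nat; lia.
Qed.

(** Reversing the product turns [poch (z - l) l] into [poch (1 - z) l] up to sign. This stands in
    for the reflection formula. *)
Lemma invGamma_subn_bounded (M : nat) : (0 < M)%N ->
  exists2 B : R, 0 <= B & forall l z, nrm z <= M%:R ->
    nrm (invGamma (z - l%:R)) <= B * l`!%:R * l.+1%:R `^ (- complex.Re z).
Proof.
move=> M0; have [B1 B10 h1] := invGamma_bounded M0.
have [B2 B20 h2] := poch_bounded (ltn0Sn M).
exists (B1 * B2) => [|l z zM]; first by rewrite mulr_ge0.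
rewrite (poch_invGamma _ l) subrK nrmM.
have -> : nrm (poch (z - l%:R) l) = nrm (poch (1 - z) l).
  rewrite /poch !nrm_prod (reindex_inj rev_ord_inj) /=.
  apply: eq_bigr => i _; rewrite -nrmN; congr nrm.
  by rewrite natrB ?ltn_ord // -natr1; ring.
have := h2 l (1 - z); rewrite ReD ReN Re1 addrAC subrr add0r.
move=> /(_ _)/(ler_pM (nrm_ge0 _) (nrm_ge0 _)) h.
rewrite (le_trans (h _ _ _ (h1 _ zM))) //; last by rewrite [leRHS](_ : _ = B2 * l`!%:R * l.+1%:R `^ (- complex.Re z) * B1) //; ring.
by rewrite (le_trans (nrmD _ _)) // nrmN nrm1 -natr1 addrC lerD2r.
Qed.

(** Dividing [invGamma z] by [poch z l] is not uniform near the zeros of [poch]. Large [l] are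
    therefore handled by [stirling_ratio_le2], and [l <= k + 1] by boundedness on a larger disc. *)
Lemma invGamma_addn_bounded (M : nat) : (0 < M)%N ->
  exists2 B : R, 0 <= B & forall l z, nrm z <= M%:R ->
    nrm (invGamma (z + l%:R)) <= B / l`!%:R * l.+1%:R `^ (1 - complex.Re z).
Proof.
move=> M0; set k := (40 * M ^ 2)%N.
have M1 : (1 : R) <= M%:R by rewrite ler1n.
have [|B1 B10 h1] := @invGamma_bounded (M + k.+1); first by rewrite addn_gt0 M0.
pose B2 : R := B1 * k.+1`!%:R * k.+2%:R `^ (M%:R + 1).
pose B3 : R := 2 * 3 `^ M%:R.
have B20 : 0 <= B2 by rewrite !mulr_ge0 ?powR_ge0.
have B30 : 0 <= B3 by rewrite !mulr_ge0 ?powR_ge0.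
exists (B2 + B3) => [|l z zM]; first by rewrite addr_ge0.
have xM := le_trans (ler_Re_nrm z) zM.
set x := complex.Re z in xM *.
have [lk|] := leqP l k.+1.
  rewrite (@le_trans _ _ (B2 / l`!%:R * l.+1%:R `^ (1 - x))) //; last first.
    by rewrite ler_wpM2r ?powR_ge0 // ler_wpM2r ?invr_ge0 // lerDl.
  apply: (@le_trans _ _ B1).
    apply: h1; apply: le_trans (nrmD _ _) _; rewrite nrm_nat natrD lerD // ler_nat //.
  rewrite (_ : B2 / _ * _ = B1 * ((k.+1`!%:R / l`!%:R) *
     (k.+2%:R `^ (M%:R + 1) * l.+1%:R `^ (1 - x)))); last by rewrite /B2; ring.
  rewrite ler_peMr // -[leLHS]mulr1 ler_pM //.
    by rewrite ler_pdivlMr ?ltr0n ?fact_gt0 // mul1r ler_nat leq_fact.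
  have x1 : `|1 - x| <= M%:R + 1.
    by rewrite (le_trans (ler_normB _ _)) // normr1 addrC lerD2r.
  have /andP[p _] := @ler_powR_abs l.+1%:R (1 - x) (M%:R + 1) (ler1n _ l.+1) x1.
  rewrite (@le_trans _ _ (k.+2%:R `^ (M%:R + 1) * l.+1%:R `^ (- (M%:R + 1)))) //; last first.
    by rewrite ler_wpM2l ?powR_ge0.
  by rewrite powRN ler_pdivlMr ?powR_gt0 ?ltr0n // mul1r ge0_ler_powR ?nnegrE ?ler_nat.
case: l => [//|[//|l]]; rewrite ltnS => kl.
have := stirling_ratio_le2 M0 zM (kl : (k <= l)%N).
rewrite /stirling_ratio 2!nrmM nrm_nat nrm_natcpow // -mulrA.
have f0 : (0 : R) < l.+1`!%:R by rewrite ltr0n fact_gt0.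
have p0 : (0 : R) < l.+1%:R `^ x by rewrite powR_gt0.
rewrite -ler_pdivlMr; last by rewrite mulr_gt0.
move=> /le_trans; apply.
rewrite (@le_trans _ _ (B3 / l.+2`!%:R * l.+3%:R `^ (1 - x))) //; last first.
  by rewrite ler_wpM2r ?powR_ge0 // ler_wpM2r ?invr_ge0 // lerDr.
rewrite invfM -powRN [l.+2`!]factS natrM invfM /B3 powRD ?powRr1 ?pnatr_eq0 ?implybT //.
have l3 : (l.+1%:R : R) `^ (- x) <= 3 `^ M%:R * l.+3%:R `^ (- x).
  by apply: powR_comparable; rewrite ?ltr0n ?normrN // -natrM ler_nat; lia.
apply: (@le_trans _ _ (2 * (l.+1`!%:R^-1 * (3 `^ M%:R * l.+3%:R `^ (- x))))).
  by rewrite ler_wpM2l // ler_wpM2l // invr_ge0 ltW.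
have -> : 2 * 3 `^ M%:R * (l.+2%:R^-1 / l.+1`!%:R) * (l.+3%:R * l.+3%:R `^ (- x))
  = 2 * (l.+1`!%:R^-1 * (3 `^ M%:R * l.+3%:R `^ (- x))) * (l.+3%:R / l.+2%:R) by ring.
rewrite ler_peMr //.
by rewrite ler_pdivlMr ?ltr0n // mul1r ler_nat.
Qed.

End GammaBounds.

(** * Bilateral series *)

Section BilateralSums.

(** The partial sum over [|l| <= B]. The symmetric range makes the reflection [l -> - l] exact at
    every finite stage and matches the boxes of signatures. *)
Definition bsum (V : zmodType) (u : int -> V) (B : nat) : V :=
  u 0 + \sum_(k < B) (u k.+1%:Z + u (- k.+1%:Z)).

Lemma bsumS (V : zmodType) (u : int -> V) B :
  bsum u B.+1 = bsum u B + (u B.+1%:Z + u (- B.+1%:Z)).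
Proof. by rewrite /bsum big_ord_recr /= addrA. Qed.

Lemma eq_bsum (V : zmodType) (u v : int -> V) B : u =1 v -> bsum u B = bsum v B.
Proof.
by move=> uv; rewrite /bsum uv; congr (_ + _); apply: eq_bigr => i _; rewrite !uv.
Qed.

Lemma bsumD (V : zmodType) (u v : int -> V) B :
  bsum (fun l => u l + v l) B = bsum u B + bsum v B.
Proof.
elim: B => [|B IH]; first by rewrite /bsum !big_ord0 !addr0.
rewrite !bsumS IH /=; move: (bsum u B) (bsum v B) => U V'.
by rewrite [u _ + v _ + _]addrACA [LHS]addrACA.
Qed.

Lemma bsumN (V : zmodType) (u : int -> V) B :
  bsum (fun l => - u l) B = - bsum u B.
Proof.
elim: B => [|B IH]; first by rewrite /bsum !big_ord0 !addr0.
by rewrite !bsumS IH !opprD.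
Qed.

Lemma bsumM (A : pzRingType) c (u : int -> A) B :
  bsum (fun l => c * u l) B = c * bsum u B.
Proof.
elim: B => [|B IH]; first by rewrite /bsum !big_ord0 !addr0.
by rewrite !bsumS IH !mulrDr.
Qed.

Lemma bsum_opp (V : zmodType) (u : int -> V) B :
  bsum (fun l => u (- l)) B = bsum u B.
Proof.
rewrite /bsum oppr0; congr (_ + _); apply: eq_bigr => i _.
by rewrite opprK addrC.
Qed.

Lemma bsum_telescope (V : zmodType) (g : int -> V) B :
  bsum (fun l => g (l + 1) - g l) B = g B.+1%:Z - g (- B%:Z).
Proof.
elim: B => [|B IH]; first by rewrite /bsum big_ord0 addr0 add0r oppr0.
rewrite bsumS IH.
have -> : B.+1%:Z + 1 = B.+2%:Z by rewrite -PoszD addn1.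
have -> : - B.+1%:Z + 1 = - B%:Z by rewrite -addn1 PoszD opprD subrK.
move: (g B.+1%:Z) (g (- B%:Z)) (g B.+2%:Z) (g (- B.+1%:Z)) => a b c d.
by rewrite addrA [a - b + _]addrC !addrA !subrK.
Qed.

Lemma bsum_ord (V : zmodType) (u : int -> V) B :
  \sum_(i < (B.*2).+1) u (i%:Z - B%:Z) = bsum u B.
Proof.
elim: B => [|B IH]; first by rewrite big_ord1 subr0 /bsum big_ord0 addr0.
rewrite bsumS -IH doubleS [LHS]big_ord_recl [X in _ + X]big_ord_recr /=.
rewrite [LHS]addrC -[LHS]addrA; congr (_ + _).
  apply: eq_bigr => i _; congr u.
  by rewrite /bump /= !PoszD -addn1 PoszD; ring.
congr (_ + _); congr u; rewrite /bump /=; last by rewrite sub0r.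
by rewrite -addnn; lia.
Qed.

Lemma ler_bsum (R : numDomainType) (u v : int -> R) B :
  (forall l, u l <= v l) -> bsum u B <= bsum v B.
Proof. by move=> uv; rewrite lerD // ler_sum // => i _; rewrite lerD. Qed.

End BilateralSums.

(** * Convergence and contiguity of Dougall's series *)

Section BilateralSeries.
Variable R : realType.
Local Notation C := (Cplx R).
Implicit Types (z w u : C) (x y e : R).

Lemma nrm_bsum (u : int -> C) B : nrm (bsum u B) <= bsum (fun l => nrm (u l)) B.
Proof.
elim: B => [|B IH]; first by rewrite /bsum !big_ord0 !addr0.
by rewrite !bsumS (le_trans (nrmD _ _)) // lerD // nrmD.
Qed.

(** Replaces the comparison with an integral: the quotient of the two powers on the right is
    [expR (e * (ln (n + 2) - ln (n + 1)))], which is at least [1 + e / (n + 2)]. *)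
Lemma powRN_telescope (n : nat) e : 0 < e ->
  e * n.+2%:R `^ (- 1 - e) <= n.+1%:R `^ (- e) - n.+2%:R `^ (- e) :> R.
Proof.
move=> e0; have /andP[h _] := @ln_succ_bounds R n.+1 isT.
have p : (n.+1%:R : R) `^ (- e) = n.+2%:R `^ (- e) *
    expR (e * (ln (n.+2%:R : R) - ln (n.+1%:R : R))).
  by rewrite /powR !pnatr_eq0 /= -expRD; congr expR; ring.
rewrite p -[X in _ <= _ - X]mulr1 -mulrBr powRD ?pnatr_eq0 ?implybT //.
rewrite powR_inv1 // mulrA [leLHS]mulrC ler_wpM2l ?powR_ge0 //.
rewrite lerBrDl (le_trans _ (expR_ge1Dx _)) // lerD2l ler_wpM2l //.
exact: ltW.
Qed.

Definition zweight (e : R) (l : int) : R := (`|l|%N.+1)%:R `^ e.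

Lemma zweight_ge0 e l : 0 <= zweight e l. Proof. exact: powR_ge0. Qed.

Lemma bsum_zweight_tail m n e : 0 < e -> (m <= n)%N ->
  bsum (zweight (- 1 - e)) n - bsum (zweight (- 1 - e)) m
    <= 2 / e * (m.+1%:R `^ (- e) - n.+1%:R `^ (- e)).
Proof.
move=> e0 mn; rewrite -(subnKC mn); elim: (n - m)%N => [|j IH].
  by rewrite addn0 !subrr mulr0.
rewrite addnS bsumS addrAC; set k := (m + j)%N in IH *.
have := powRN_telescope k e0; rewrite -ler_pdivlMl // => h.
have -> : 2 / e * (m.+1%:R `^ (- e) - k.+2%:R `^ (- e))
   = 2 / e * (m.+1%:R `^ (- e) - k.+1%:R `^ (- e)) +
     (e^-1 * (k.+1%:R `^ (- e) - k.+2%:R `^ (- e)) + e^-1 * (k.+1%:R `^ (- e) - k.+2%:R `^ (- e))) by ring.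
by rewrite lerD // lerD.
Qed.

Lemma bsum_zweight_le n e : 0 < e -> bsum (zweight (- 1 - e)) n <= 1 + 2 / e.
Proof.
move=> e0; have := bsum_zweight_tail e0 (leq0n n).
have -> : bsum (zweight (- 1 - e)) 0 = 1.
  by rewrite /bsum big_ord0 addr0 /zweight absz0 powR1.
rewrite powR1 lerBlDr => h.
rewrite (le_trans h) // addrC lerD2l ler_piMr ?divr_ge0 ?gerBl ?powR_ge0 //.
exact: ltW.
Qed.

Lemma cvg_powRN0 e : 0 < e -> ((n.+1%:R : R) `^ (- e)) @[n --> \oo] --> (0 : R).
Proof.
move=> e0; apply/cvgr0Pnorm_lt => d d0.
have [m hm] : exists m : nat, d `^ (- e^-1) < m%:R.
  by have h := archi_boundP (powR_ge0 d (- e^-1)); eexists; exact: h.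
exists m => // n /= mn; rewrite ger0_norm ?powR_ge0 //.
have {}hm : d `^ (- e^-1) < n.+1%:R.
  by rewrite (lt_le_trans hm) // ler_nat leqW.
rewrite powRN invf_plt ?posrE ?powR_gt0 //.
have -> : d^-1 = (d `^ (- e^-1)) `^ e.
  by rewrite -powRrM mulNr mulVf ?gt_eqF // powRN powRr1 // ltW.
by rewrite gt0_ltr_powR // ?nnegrE ?powR_ge0.
Qed.

Lemma is_cvg_bsum (u : int -> C) c e : 0 < e ->
  (forall l, nrm (u l) <= c * zweight (- 1 - e) l) -> cvgn (bsum u).
Proof.
move=> e0 h; apply: is_cvg_cauchyC => d d0.
have c0 : 0 <= c.
  by have := le_trans (nrm_ge0 _) (h 0); rewrite /zweight absz0 powR1 mulr1.
have [d' d'0 hd] : exists2 d', 0 < d' & c * (2 / e) * d' <= d.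
  have q0 : 0 <= c * (2 / e) by rewrite mulr_ge0 // divr_ge0 // ltW.
  have q1 : 0 < 1 + c * (2 / e) by rewrite ltr_wpDr.
  exists (d / (1 + c * (2 / e))); first by rewrite divr_gt0.
  by rewrite mulrA ler_pdivrMr // mulrC ler_wpM2l ?lerDr // ltW.
have /cvgr0Pnorm_lt/(_ _ d'0)[m _ hm] := cvg_powRN0 e0.
exists m => n mn.
have {hm} := hm m (leqnn m); rewrite /= ger0_norm ?powR_ge0 // => hm.
apply: le_trans hd.
have step k : nrm (bsum u (m + k) - bsum u m) <=
    c * (bsum (zweight (- 1 - e)) (m + k) - bsum (zweight (- 1 - e)) m).
  elim: k => [|k IH]; first by rewrite addn0 !subrr nrm0 mulr0.
  have aux (U U' v : C) (P P' x : R) : nrm (U - U') <= c * (P - P') ->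
      nrm v <= c * x -> nrm (U + v - U') <= c * (P + x - P').
    move=> h1 h2; rewrite addrAC [P + x - _]addrAC mulrDr.
    by rewrite (le_trans (nrmD _ _)) // lerD.
  rewrite addnS !bsumS; apply: aux => //.
  by rewrite mulrDr (le_trans (nrmD _ _)) // lerD.
rewrite -(subnKC mn) (le_trans (step _)) // -[leRHS]mulrA ler_wpM2l //.
rewrite (le_trans (bsum_zweight_tail e0 (leq_addr _ _))) //.
rewrite ler_wpM2l ?divr_ge0 ?ltW //.
by rewrite (le_lt_trans _ hm) // gerBl powR_ge0.
Qed.

Definition hterm z z' w w' (l : int) : C :=
  invGamma (z - l%:~R + 1) * invGamma (z' - l%:~R + 1) *
  invGamma (w + l%:~R + 1) * invGamma (w' + l%:~R + 1).

(** One argument decreases with [l] and the other increases, so the factors [l!] and [1 / l!] of the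
    two bounds cancel and a power of [|l| + 1] remains. For negative [l] the two factors exchange
    roles. *)
Lemma invGamma_pair_bounded (M : nat) : exists2 B : R, 0 <= B &
  forall (l : int) z w, nrm z <= M%:R -> nrm w <= M%:R ->
    nrm (invGamma (z - l%:~R + 1) * invGamma (w + l%:~R + 1))
      <= B * zweight (- complex.Re (z + w) - 1) l.
Proof.
have [B1 B10 h1] := @invGamma_subn_bounded R M.+1 isT.
have [B2 B20 h2] := @invGamma_addn_bounded R M.+1 isT.
have key n z w : nrm z <= M%:R -> nrm w <= M%:R ->
    nrm (invGamma (z - n%:R + 1) * invGamma (w + n%:R + 1))
      <= B1 * B2 * n.+1%:R `^ (- complex.Re (z + w) - 1).
  move=> zM wM; rewrite nrmM (addrAC z) (addrAC w).
  have b u : nrm u <= M%:R -> nrm (u + 1) <= M.+1%:R.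
    by move=> uM; rewrite (le_trans (nrmD _ _)) // nrm1 -natr1 lerD2r.
  have := ler_pM (nrm_ge0 _) (nrm_ge0 _) (h1 n _ (b _ zM)) (h2 n _ (b _ wM)).
  move=> /le_trans; apply; rewrite !ReD Re1.
  set x := complex.Re z; set y := complex.Re w.
  have -> : - (x + y) - 1 = - (x + 1) + (1 - (y + 1)) by ring.
  rewrite [X in _ <= _ * X]powRD ?pnatr_eq0 ?implybT //.
  rewrite le_eqVlt; apply/orP; left; apply/eqP.
  by field; rewrite pnatr_eq0 -lt0n fact_gt0.
exists (B1 * B2) => [|l z w zM wM]; first by rewrite mulr_ge0.
case: l => n; first exact: key.
have := key n.+1 w z wM zM.
by rewrite [X in nrm X]mulrC (addrC w z) NegzE mulrNz opprK /zweight abszN.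
Qed.

Lemma hterm_bounded (M : nat) : exists2 B : R, 0 <= B &
  forall (l : int) z z' w w',
    nrm z <= M%:R -> nrm z' <= M%:R -> nrm w <= M%:R -> nrm w' <= M%:R ->
    nrm (hterm z z' w w' l) <= B * zweight (- complex.Re (z + z' + w + w') - 2) l.
Proof.
have [B B0 h] := invGamma_pair_bounded M.
exists (B * B) => [|l z z' w w' h1 h2 h3 h4]; first by rewrite mulr_ge0.
have -> : hterm z z' w w' l =
    (invGamma (z - l%:~R + 1) * invGamma (w + l%:~R + 1)) *
    (invGamma (z' - l%:~R + 1) * invGamma (w' + l%:~R + 1)).
  by rewrite /hterm; ring.
rewrite nrmM.
apply: le_trans (ler_pM (nrm_ge0 _) (nrm_ge0 _) (h l _ _ h1 h3) (h l _ _ h2 h4)) _.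
rewrite mulrACA /zweight -powRD ?pnatr_eq0 ?implybT //.
rewrite le_eqVlt; apply/orP; left; apply/eqP; congr (_ * (_ `^ _)).
by rewrite !ReD; ring.
Qed.

Lemma nat_bound4 z z' w w' : exists M : nat,
  [/\ nrm z <= M%:R, nrm z' <= M%:R, nrm w <= M%:R & nrm w' <= M%:R].
Proof.
have [a _ ha] := nat_bound z; have [b _ hb] := nat_bound z'.
have [c _ hc] := nat_bound w; have [d _ hd] := nat_bound w'.
exists (a + b + c + d)%N.
by split; [move: ha | move: hb | move: hc | move: hd] => /le_trans; apply;
  rewrite ler_nat; lia.
Qed.

Definition hsum z z' w w' : C := limn (bsum (hterm z z' w w')).

Lemma cvg_hsum z z' w w' : -1 < complex.Re (z + z' + w + w') ->
  bsum (hterm z z' w w') n @[n --> \oo] --> hsum z z' w w'.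
Proof.
move=> a1; have [M [h1 h2 h3 h4]] := nat_bound4 z z' w w'.
have [B B0 h] := hterm_bounded M.
have e0 : 0 < complex.Re (z + z' + w + w') + 1 by lra.
apply: (is_cvg_bsum e0 (c := B)) => l; apply: le_trans (h _ _ _ _ _ h1 h2 h3 h4) _.
by rewrite le_eqVlt; apply/orP; left; apply/eqP; congr (_ * zweight _ _); ring.
Qed.

(** These are the boundary terms of [bsum_telescope]. They vanish in the limit already above -2, one
    unit before the series converges; [hsum_shift] needs this margin because its [g] has parameter
    sum [z + z' + w + w' - 1]. *)
Lemma cvg_hterm0 z z' w w' : -2 < complex.Re (z + z' + w + w') ->
  hterm z z' w w' n.+1%:Z @[n --> \oo] --> (0 : C) /\
  hterm z z' w w' (- n%:Z) @[n --> \oo] --> (0 : C).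
Proof.
move=> a1; have [M [h1 h2 h3 h4]] := nat_bound4 z z' w w'.
have [B B0 h] := hterm_bounded M.
set e := complex.Re (z + z' + w + w') + 2.
have e0 : 0 < e by rewrite /e; lra.
have h0 : (fun n => B * (n.+1%:R : R) `^ (- e)) @ \oo --> (0 : R).
  by rewrite -(mulr0 B); apply: cvgM; [exact: cvg_cst | exact: cvg_powRN0].
have ee : - complex.Re (z + z' + w + w') - 2 = - e by rewrite /e; ring.
split; apply: (@cvgC_dist R _ _ _ _ _ _ _ h0); apply: nearW => n; rewrite subr0;
  apply: le_trans (h _ _ _ _ _ h1 h2 h3 h4) _; rewrite /zweight ?abszN absz_nat ee //.
rewrite ler_wpM2l // !powRN lef_pV2 ?posrE ?powR_gt0 //.
by rewrite ge0_ler_powR ?nnegrE ?ltW // ?ler0n // ltr_nat.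
Qed.

Lemma hsum_swap z z' w w' : hsum z z' w w' = hsum z' z w w'.
Proof.
rewrite /hsum; congr (limn _); apply/funext => B.
by apply: eq_bsum => l; rewrite /hterm [invGamma (z - _ + _) * _]mulrC.
Qed.

Lemma hsum_reflect z z' w w' : hsum z z' w w' = hsum w w' z z'.
Proof.
rewrite /hsum; congr (limn _); apply/funext => B.
rewrite -bsum_opp; apply: eq_bsum => l; rewrite /hterm !mulrNz !opprK; ring.
Qed.

(* The relation holds termwise up to the difference [g (l + 1) - g l]. *)
Lemma hsum_shift z z' w w' : -1 < complex.Re (z + z' + w + w') ->
  (z' + w + 1) * (z' + w' + 1) * hsum z (z' + 1) w w'
    = (z + z' + w + w' + 1) * hsum z z' w w'.
Proof.
move=> a1; set a := z + z' + w + w'.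
pose g := hterm z (z' + 1) (w - 1) (w' - 1).
have gE l : g l = (w + l%:~R) * (w' + l%:~R) * hterm z (z' + 1) w w' l.
  rewrite /g /hterm ![_ - 1 + _ + 1]addrAC !subrK.
  by rewrite (invGammaS (w + _)) (invGammaS (w' + _)); ring.
have gS l : g (l + 1) = (z - l%:~R) * (z' + 1 - l%:~R) * hterm z (z' + 1) w w' l.
  rewrite /g /hterm intrD.
  have -> : z - (l%:~R + 1) + 1 = z - l%:~R by ring.
  have -> : z' + 1 - (l%:~R + 1) + 1 = z' + 1 - l%:~R by ring.
  have -> v : v - 1 + (l%:~R + 1) + 1 = v + l%:~R + 1 :> C by ring.
  have -> v : v - 1 + (l%:~R + 1) + 1 = v + l%:~R + 1 :> C by ring.
  by rewrite (invGammaS (z - _)) (invGammaS (z' + 1 - _)); ring.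
have tE l : hterm z z' w w' l = (z' + 1 - l%:~R) * hterm z (z' + 1) w w' l.
  rewrite /hterm [z' - _ + 1]addrAC (invGammaS (z' + 1 - _)); ring.
(* With [p = w + l], [q = w' + l], [r = z - l], [s = z' + 1 - l] this is the identity [(s + p) (s +
   q) - (r + s + p + q) s = p q - r s]. *)
have tel l : (z' + w + 1) * (z' + w' + 1) * hterm z (z' + 1) w w' l
    + - ((a + 1) * hterm z z' w w' l) = - (g (l + 1) - g l).
  by rewrite gS gE tE /a; ring.
have a2 : -2 < complex.Re (z + (z' + 1) + (w - 1) + (w' - 1)).
  by move: a1; rewrite !ReD !ReN !Re1; lra.
have [l1 l2] := cvg_hterm0 a2.
apply/eqP; rewrite -subr_eq0; apply/eqP.
have c1 : (fun B => (z' + w + 1) * (z' + w' + 1) * bsum (hterm z (z' + 1) w w') B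
    + - ((a + 1) * bsum (hterm z z' w w') B)) @ \oo -->
   (z' + w + 1) * (z' + w' + 1) * hsum z (z' + 1) w w' - (a + 1) * hsum z z' w w'.
  apply: cvgB; (apply: cvgM; first exact: cvg_cst); apply: cvg_hsum => //.
  by move: a1; rewrite !ReD !Re1; lra.
have c2 : (fun B : nat => - (g B.+1%:Z - g (- B%:Z))) @ \oo --> - ((0 : C) - 0).
  by apply: cvgN; apply: cvgB; [exact: l1 | exact: l2].
rewrite subrr oppr0 in c2.
apply: cvg_unique c1 _ => //; apply: cvg_trans c2; apply: near_eq_cvg.
apply: nearW => B; rewrite -bsum_telescope -bsumN -!bsumM -bsumN -bsumD.
by apply: eq_bsum => l; rewrite tel.
Qed.

End BilateralSeries.

(** * Dougall's bilateral formula *)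

Section Dougall.
Variable R : realType.
Local Notation C := (Cplx R).
Implicit Types (z w u : C) (x y e : R).

Definition dougall_lhs z z' w w' : C :=
  invGamma (z + z' + w + w' + 1) * hsum z z' w w'.

Definition dougall_rhs z z' w w' : C :=
  invGamma (z + w + 1) * invGamma (z + w' + 1) *
  invGamma (z' + w + 1) * invGamma (z' + w' + 1).

Lemma dougall_step z z' w w' : -1 < complex.Re (z + z' + w + w') ->
  dougall_lhs z z' w w'
    = (z' + w + 1) * (z' + w' + 1) * dougall_lhs z (z' + 1) w w' /\
  dougall_rhs z z' w w'
    = (z' + w + 1) * (z' + w' + 1) * dougall_rhs z (z' + 1) w w'.
Proof.
move=> a1; rewrite /dougall_lhs /dougall_rhs.
rewrite (_ : z + (z' + 1) + w + w' = z + z' + w + w' + 1); last by ring.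
split.
  rewrite [RHS]mulrCA hsum_shift // (invGammaS (z + z' + w + w' + 1)); ring.
rewrite (invGammaS (z' + w + 1)) (invGammaS (z' + w' + 1)).
rewrite (_ : z' + 1 + w = z' + w + 1); last by ring.
rewrite (_ : z' + 1 + w' = z' + w' + 1); last by ring.
by ring.
Qed.

Lemma dougall_lhs_swap z z' w w' : dougall_lhs z z' w w' = dougall_lhs z' z w w'.
Proof. by rewrite /dougall_lhs hsum_swap (addrC z). Qed.

Lemma dougall_rhs_swap z z' w w' : dougall_rhs z z' w w' = dougall_rhs z' z w w'.
Proof. by rewrite /dougall_rhs; ring. Qed.

Lemma dougall_lhs_reflect z z' w w' : dougall_lhs z z' w w' = dougall_lhs w w' z z'.
Proof. by rewrite /dougall_lhs hsum_reflect; congr (invGamma _ * _); ring. Qed.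

Lemma dougall_rhs_reflect z z' w w' : dougall_rhs z z' w w' = dougall_rhs w w' z z'.
Proof.
rewrite /dougall_rhs ![w + _]addrC ![w' + _]addrC; ring.
Qed.

Definition dougall_sides z z' w w' :=
  (dougall_lhs z z' w w', dougall_rhs z z' w w').

(** A common factor instead of an equality of quotients: the contiguity factors may vanish, and
    equality at the shifted parameters [q] still implies equality at [p]. *)
Definition proportional (p q : C * C) := exists c, p.1 = c * q.1 /\ p.2 = c * q.2.

Lemma proportional_trans q p r :
  proportional p q -> proportional q r -> proportional p r.
Proof.
move=> [c [h1 h2]] [d [h3 h4]]; exists (c * d).
by rewrite h1 h2 h3 h4 !mulrA.
Qed.

Lemma dougall_shift1 z z' w w' : -1 < complex.Re (z + z' + w + w') ->
  proportional (dougall_sides z z' w w')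
    (dougall_sides (z + 1) (z' + 1) (w + 1) (w' + 1)).
Proof.
move=> a1.
have sw u u' v v' : dougall_sides u u' v v' = dougall_sides u' u v v'.
  by rewrite /dougall_sides dougall_lhs_swap dougall_rhs_swap.
have rf u u' v v' : dougall_sides u u' v v' = dougall_sides v v' u u'.
  by rewrite /dougall_sides dougall_lhs_reflect dougall_rhs_reflect.
have st u u' v v' : -1 < complex.Re (u + u' + v + v') ->
    proportional (dougall_sides u u' v v') (dougall_sides u (u' + 1) v v').
  by move=> /dougall_step[h1 h2]; eexists; split; [exact: h1 | exact: h2].
apply: (@proportional_trans (dougall_sides z (z' + 1) w w')); first exact: st.
apply: (@proportional_trans (dougall_sides (z + 1) (z' + 1) w w')).
  by rewrite sw [X in proportional _ X]sw; apply: st; move: a1; rewrite !ReD Re1; lra.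
rewrite rf [X in proportional _ X]rf.
apply: (@proportional_trans (dougall_sides w (w' + 1) (z + 1) (z' + 1))).
  by apply: st; move: a1; rewrite !ReD Re1; lra.
by rewrite sw [X in proportional _ X]sw; apply: st; move: a1; rewrite !ReD Re1; lra.
Qed.

Lemma dougall_shift n z z' w w' : -1 < complex.Re (z + z' + w + w') ->
  proportional (dougall_sides z z' w w')
    (dougall_sides (z + n%:R) (z' + n%:R) (w + n%:R) (w' + n%:R)).
Proof.
move=> a1; elim: n => [|n IH]; first by rewrite !addr0; exists 1; rewrite !mul1r.
apply: (proportional_trans IH).
have sS u : u + n.+1%:R = u + n%:R + 1 by rewrite -natr1 addrA.
rewrite !sS; apply: dougall_shift1.
by have n0 : (0 : R) <= n%:R by []; move: a1; rewrite !ReD Re_nat; lra.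
Qed.

Lemma hsum0 : hsum (0 : C) 0 0 0 = 1.
Proof.
rewrite /hsum (_ : bsum _ = fun=> 1); first by rewrite lim_cst.
apply/funext => B; rewrite /bsum big1 ?addr0 => [|i _].
  by rewrite /hterm mulr0z oppr0 !add0r invGamma1 !mulr1.
rewrite /hterm !add0r !mulrNz opprK.
have -> : - (i.+1%:~R) + 1 = - i%:R :> C by rewrite -pmulrn -natr1; ring.
by rewrite invGamma_opp_nat !(mulr0, mul0r) addr0.
Qed.

Lemma dougall_rhs_neq0 z z' w w' : 0 <= complex.Re z -> 0 <= complex.Re z' ->
  0 <= complex.Re w -> 0 <= complex.Re w' -> dougall_rhs z z' w w' != 0.
Proof.
move=> h1 h2 h3 h4; rewrite !mulf_neq0 // invGamma_Re_gt0 // !ReD Re1; lra.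
Qed.

Definition dougall_quotient z z' w w' : C :=
  dougall_lhs z z' w w' / dougall_rhs z z' w w'.

Lemma dougall_quotient_shift n z z' w w' : 0 <= complex.Re z ->
  0 <= complex.Re z' -> 0 <= complex.Re w -> 0 <= complex.Re w' ->
  dougall_quotient (z + n%:R) (z' + n%:R) (w + n%:R) (w' + n%:R)
    = dougall_quotient z z' w w'.
Proof.
move=> h1 h2 h3 h4; rewrite /dougall_quotient.
have a1 : -1 < complex.Re (z + z' + w + w') by rewrite !ReD; lra.
have [c [/= -> eq_r]] := dougall_shift n a1.
have := dougall_rhs_neq0 h1 h2 h3 h4; rewrite eq_r mulf_eq0 negb_or.
move: (dougall_lhs _ _ _ _) (dougall_rhs _ _ _ _) => L L' /andP[c0 r0].
by field; rewrite c0 r0.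
Qed.

Lemma cvg_comp_nat (f : nat -> C) (phi : nat -> nat) (l : C) :
  (forall n, (n <= phi n)%N) -> f @ \oo --> l -> f (phi n) @[n --> \oo] --> l.
Proof.
move=> h; apply: cvg_comp => A [m _ mA]; exists m => // n mn.
by apply: mA => /=; exact: leq_trans (h n).
Qed.

(* The value of [hsum n%:R n%:R n%:R n%:R], that is, the sum over [l] of
   [1 / ((n - l)! (n + l)!) ^ 2]. *)
Definition dscale n : C := (4 * n)%N`!%:R / ((2 * n)%N`!%:R ^+ 4).

(** Normalises the shifted terms: their sum becomes [dougall_quotient] times [dnorm], and [dnorm]
    tends to 1. For zero parameters it reduces to [1 / dscale n]. *)
Definition dweight z z' w w' n : C := natcpow n (z + z' + w + w') / dscale n.

Definition dnorm z z' w w' n : C :=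
  dougall_rhs (z + n%:R) (z' + n%:R) (w + n%:R) (w' + n%:R) /
  invGamma (z + z' + w + w' + (4 * n)%N.+1%:R) * dweight z z' w w' n.

(** The powers of 2 and of [n] cancel exactly, because [4n * n = (2n)^2] and the four sums [z + w],
    [z + w'], [z' + w], [z' + w'] add up to twice the total. *)
Lemma dnormE z z' w w' n : (0 < n)%N ->
  invGamma (z + z' + w + w' + (4 * n)%N.+1%:R) != 0 ->
  dnorm z z' w w' n =
    stirling_ratio (2 * n)%N (z + w) * stirling_ratio (2 * n)%N (z + w') *
    stirling_ratio (2 * n)%N (z' + w) * stirling_ratio (2 * n)%N (z' + w') /
    stirling_ratio (4 * n)%N (z + z' + w + w').
Proof.
move=> n0 i0; rewrite /dnorm /stirling_ratio /dougall_rhs /dweight /dscale.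
have e u v : u + n%:R + (v + n%:R) + 1 = u + v + (2 * n)%N.+1%:R :> C.
  by rewrite -natr1 natrM; ring.
rewrite !e; set a := z + z' + w + w'.
have p4 : natcpow (4 * n)%N a * natcpow n a = natcpow (2 * n)%N (z + w) *
    natcpow (2 * n)%N (z + w') * natcpow (2 * n)%N (z' + w) * natcpow (2 * n)%N (z' + w').
  rewrite -natcpowM ?muln_gt0 // (_ : (4 * n * n = 2 * n * (2 * n)%N)%N); last by lia.
  by rewrite natcpowM ?muln_gt0 // -!natcpowD; congr (natcpow _ _); rewrite /a; ring.
have f2 : (2 * n)%N`!%:R != 0 :> C by exact: fact_neq0.
have f4 : (4 * n)%N`!%:R != 0 :> C by exact: fact_neq0.
have q4 := natcpow_neq0 (4 * n)%N a.
rewrite (_ : natcpow n a = natcpow (2 * n)%N (z + w) *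
    natcpow (2 * n)%N (z + w') * natcpow (2 * n)%N (z' + w) * natcpow (2 * n)%N (z' + w')
    / natcpow (4 * n)%N a); last by rewrite -p4 mulrAC mulfV // mul1r.
by field; rewrite f2 f4 q4 i0.
Qed.

(** A predicate rather than the condition [0 < Re z], because the comparison case has parameter 0,
    where the ratio is identically 1. *)
Definition stirling_ok z := stirling_ratio k z @[k --> \oo] --> (1 : C).

Lemma cvg_dnorm z z' w w' : stirling_ok (z + w) -> stirling_ok (z + w') ->
  stirling_ok (z' + w) -> stirling_ok (z' + w') ->
  stirling_ok (z + z' + w + w') -> 0 <= complex.Re (z + z' + w + w') ->
  dnorm z z' w w' n @[n --> \oo] --> (1 : C).
Proof.
move=> h1 h2 h3 h4 h5 a0.
have c2 u : stirling_ok u -> stirling_ratio (2 * n)%N u @[n --> \oo] --> (1 : C).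
  move=> h; apply: (@cvg_comp_nat ((@stirling_ratio R)^~ u) (fun n => 2 * n)%N _ _ h).
  by move=> n; lia.
have c4 u : stirling_ok u -> stirling_ratio (4 * n)%N u @[n --> \oo] --> (1 : C).
  move=> h; apply: (@cvg_comp_nat ((@stirling_ratio R)^~ u) (fun n => 4 * n)%N _ _ h).
  by move=> n; lia.
have h : (fun n => stirling_ratio (2 * n)%N (z + w) * stirling_ratio (2 * n)%N (z + w') *
    stirling_ratio (2 * n)%N (z' + w) * stirling_ratio (2 * n)%N (z' + w') /
    stirling_ratio (4 * n)%N (z + z' + w + w')) @ \oo --> (1 * 1 * 1 * 1 / 1 : C).
  apply: cvgM; last by apply: cvgV; [exact: oner_neq0 | exact: c4].
  apply: cvgM; last exact: c2.
  by apply: cvgM; [apply: cvgM; exact: c2 | exact: c2].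
have e : (1 * 1 * 1 * 1 / 1 : C) = 1 by rewrite invr1 !mulr1.
rewrite e in h; apply: cvg_trans h; apply: near_eq_cvg.
exists 1 => // n n0; rewrite dnormE // invGamma_Re_gt0 // ReD Re_nat.
by rewrite ltr_wpDl // ltr0n.
Qed.

Definition dterm z z' w w' n (l : int) : C :=
  hterm (z + n%:R) (z' + n%:R) (w + n%:R) (w' + n%:R) l * dweight z z' w w' n.

Lemma dweight_hsum z z' w w' n : 0 <= complex.Re z -> 0 <= complex.Re z' ->
  0 <= complex.Re w -> 0 <= complex.Re w' ->
  dweight z z' w w' n * hsum (z + n%:R) (z' + n%:R) (w + n%:R) (w' + n%:R) =
  dougall_quotient z z' w w' * dnorm z z' w w' n.
Proof.
move=> h1 h2 h3 h4.
rewrite -(dougall_quotient_shift n) // /dougall_quotient /dougall_lhs /dnorm.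
have -> : z + n%:R + (z' + n%:R) + (w + n%:R) + (w' + n%:R) + 1
    = z + z' + w + w' + (4 * n)%N.+1%:R by rewrite -natr1 natrM; ring.
have r0 : dougall_rhs (z + n%:R) (z' + n%:R) (w + n%:R) (w' + n%:R) != 0.
  by apply: dougall_rhs_neq0; rewrite ReD Re_nat addr_ge0.
have i0 : invGamma (z + z' + w + w' + (4 * n)%N.+1%:R) != 0.
  by rewrite invGamma_Re_gt0 // !ReD Re_nat ltr_wpDl ?ltr0n // !addr_ge0.
move: (invGamma _) (dougall_rhs _ _ _ _) r0 i0 => u v r0 i0.
by field; rewrite r0 i0.
Qed.

Lemma cvg_dterm z z' w w' n : 0 <= complex.Re z -> 0 <= complex.Re z' ->
  0 <= complex.Re w -> 0 <= complex.Re w' ->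
  bsum (dterm z z' w w' n) B @[B --> \oo] -->
    dougall_quotient z z' w w' * dnorm z z' w w' n.
Proof.
move=> h1 h2 h3 h4; have n0 : (0 : R) <= n%:R by [].
rewrite -dweight_hsum //.
have h : (fun B => dweight z z' w w' n *
   bsum (hterm (z + n%:R) (z' + n%:R) (w + n%:R) (w' + n%:R)) B) @ \oo -->
   dweight z z' w w' n * hsum (z + n%:R) (z' + n%:R) (w + n%:R) (w' + n%:R).
  apply: cvgM; first exact: cvg_cst.
  by apply: cvg_hsum; rewrite !ReD Re_nat; lra.
apply: cvg_trans h; apply: near_eq_cvg; apply: nearW => B.
by rewrite -bsumM; apply: eq_bsum => l; rewrite /dterm mulrC.
Qed.

End Dougall.

(** * Second moment of the terms of Dougall's series *)

Section SecondMoment.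
Variable R : realType.
Local Notation C := (Cplx R).
Implicit Types (z w u : C) (x y e : R).

(** Write [l^2 = z^2 - (z - l) (z + l)] and [z + l = (z - w) + (w + l)]; the factor [z - l] lowers
    [z] by 1 and [w + l] lowers [w] by 1. *)
Lemma sqr_hterm z z' w w' l :
  l%:~R ^+ 2 * hterm z z' w w' l =
    z ^+ 2 * hterm z z' w w' l - (z - w) * hterm (z - 1) z' w w' l
    - hterm (z - 1) z' (w - 1) w' l.
Proof.
rewrite /hterm ![_ - 1 - _ + 1]addrAC ![_ - 1 + _ + 1]addrAC !subrK.
by rewrite (invGammaS (z - _)) (invGammaS (w + _)); ring.
Qed.

(** The second moment relative to the total mass: [sqr_hterm] summed over [l], each lowered
    parameter being replaced by its contiguity factor. *)
Definition moment_factor z z' w w' : C :=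
  let a := z + z' + w + w' in
  z ^+ 2 - (z - w) * ((z + w) * (z + w') / a)
    - (z + w) * (z + w') * ((z + w - 1) * (z' + w)) / (a * (a - 1)).

(** Two parameters are lowered in the last series, so its convergence requires the real part of
    [a - 2] to exceed -1. *)
Lemma cvg_second_moment z z' w w' : 1 < complex.Re (z + z' + w + w') ->
  bsum (fun l => l%:~R ^+ 2 * hterm z z' w w' l) n @[n --> \oo] -->
    moment_factor z z' w w' * hsum z z' w w'.
Proof.
move=> a1; set a := z + z' + w + w' in a1 *.
have a0 : a != 0.
  by apply/eqP => e; move: a1; rewrite e /=; lra.
have a10 : a - 1 != 0.
  by rewrite subr_eq0; apply/eqP => e; move: a1; rewrite e /=; lra.
have sw u v u' v' : hsum u v u' v' = hsum u' v' v u by rewrite hsum_swap hsum_reflect.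
have s1 : hsum (z - 1) z' w w' = (z + w) * (z + w') / a * hsum z z' w w'.
  have := @hsum_shift _ z' (z - 1) w w'.
  rewrite subrK ![z - 1 + _ + 1]addrAC !subrK (hsum_swap z' z) (hsum_swap z' (z - 1)).
  have -> : z' + (z - 1) + w + w' + 1 = a by rewrite /a; ring.
  move=> h; apply: (mulfI a0); rewrite -h; first by field.
  by move: a1; rewrite /a !ReD ReN Re1; lra.
have s2 : hsum (z - 1) z' (w - 1) w' = (z + w - 1) * (z' + w) / (a - 1) * hsum (z - 1) z' w w'.
  have := @hsum_shift _ w' (w - 1) (z - 1) z'.
  rewrite subrK (sw w' w) (sw w' (w - 1)).
  have -> : w - 1 + (z - 1) + 1 = z + w - 1 by ring.
  have -> : w - 1 + z' + 1 = z' + w by ring.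
  have -> : w' + (w - 1) + (z - 1) + z' + 1 = a - 1 by rewrite /a; ring.
  move=> h; apply: (mulfI a10); rewrite -h; first by field.
  by move: a1; rewrite /a !ReD ReN Re1; lra.
have -> : moment_factor z z' w w' * hsum z z' w w' =
   z ^+ 2 * hsum z z' w w' - (z - w) * hsum (z - 1) z' w w' - hsum (z - 1) z' (w - 1) w'.
  by rewrite s2 s1 /moment_factor -/a; field; rewrite a0 a10.
have h : (fun n => z ^+ 2 * bsum (hterm z z' w w') n
     - (z - w) * bsum (hterm (z - 1) z' w w') n
     - bsum (hterm (z - 1) z' (w - 1) w') n) @ \oo -->
   z ^+ 2 * hsum z z' w w' - (z - w) * hsum (z - 1) z' w w' - hsum (z - 1) z' (w - 1) w'.
  apply: cvgB; last first.
    by apply: cvg_hsum; move: a1; rewrite /a !ReD ReN Re1; lra.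
  apply: cvgB; (apply: cvgM; first exact: cvg_cst);
    by apply: cvg_hsum; move: a1; rewrite /a !ReD ?ReN ?Re1; lra.
apply: cvg_trans h; apply: near_eq_cvg; apply: nearW => n.
rewrite -!bsumM -!bsumN -!bsumD; apply: eq_bsum => l.
by rewrite sqr_hterm.
Qed.

(** This is the concentration. In the variable [e = 1 / (n + 1)] the quotient is a rational function
    whose value at 0 is [1 - (2 * 2 * 2 * 2) / (4 * 4) = 0]: the coefficients of [n^2] cancel. *)
Lemma cvg_moment_factor z z' w w' :
  moment_factor (z + n.+1%:R) (z' + n.+1%:R) (w + n.+1%:R) (w' + n.+1%:R)
    / n.+1%:R ^+ 2 @[n --> \oo] --> (0 : C).
Proof.
pose e n : C := n.+1%:R^-1.
have e0 : e @ \oo --> (0 : C) by exact: cvg_invSn.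
have lin u c : (fun n => u * e n + c) @ \oo --> (c : C).
  rewrite -[X in _ --> X]add0r -[X in _ --> X + _](mulr0 u).
  apply: cvgD; last exact: cvg_cst.
  by apply: cvgM; [exact: cvg_cst | exact: e0].
pose a := z + z' + w + w'.
have h : (fun n => (z * e n + 1) * (z * e n + 1)
   - ((z - w) * e n) * (((z + w) * e n + 2) * ((z + w') * e n + 2) / (a * e n + 4))
   - ((z + w) * e n + 2) * ((z + w') * e n + 2) * (((z + w - 1) * e n + 2) * ((z' + w) * e n + 2))
     / ((a * e n + 4) * ((a - 1) * e n + 4))) @ \oo -->
   (1 * 1 - ((z - w) * 0) * (2 * 2 / 4) - 2 * 2 * (2 * 2) / (4 * 4) : C).
  have four : (4 : C) != 0 by rewrite pnatr_eq0.
  apply: cvgB; first apply: cvgB.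
  - by apply: cvgM; exact: lin.
  - apply: cvgM; first by apply: cvgM; [exact: cvg_cst | exact: e0].
    apply: cvgM; first by apply: cvgM; exact: lin.
    by apply: cvgV; [exact: four | exact: lin].
  - apply: cvgM; first by apply: cvgM; apply: cvgM; exact: lin.
    apply: cvgV; first by rewrite mulf_neq0.
    by apply: cvgM; exact: lin.
have l0 : (1 * 1 - ((z - w) * 0) * (2 * 2 / 4) - 2 * 2 * (2 * 2) / (4 * 4) : C) = 0.
  by field.
rewrite l0 in h; apply: cvg_trans h; apply: near_eq_cvg.
have [m am] : exists m : nat, nrm a + 1 < m%:R.
  have h : 0 <= nrm a + 1 by rewrite addr_ge0 ?nrm_ge0.
  by have := archi_boundP h; eexists; eassumption.
exists m => // n /= mn; rewrite /moment_factor /e.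
have -> : z + n.+1%:R + (z' + n.+1%:R) + (w + n.+1%:R) + (w' + n.+1%:R) = a + 4 * n.+1%:R.
  by rewrite /a; ring.
have n0 : n.+1%:R != 0 :> C by rewrite pnatr_eq0.
have big u : nrm u <= nrm a + 1 -> u + 4 * n.+1%:R != 0.
  move=> hu; rewrite -nrm_gt0; have := nrm_lerB (4 * n.+1%:R) (- u).
  rewrite opprK [4 * _ + u]addrC nrmN -natrM nrm_nat natrM => h.
  apply: lt_le_trans h.
  have : m%:R <= n.+1%:R :> R by rewrite ler_nat leqW.
  by have := nrm_ge0 a; lra.
have a1 : a + 4 * n.+1%:R != 0 by apply: big; rewrite lerDl.
have a2 : a - 1 + 4 * n.+1%:R != 0.
  by apply: big; rewrite (le_trans (nrmD _ _)) // nrmN nrm1.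
have a3 : a + 4 * n.+1%:R - 1 != 0 by rewrite addrAC.
move: (n.+1%:R : C) n0 a1 a2 a3 => k k0 a1 a2 a3.
have a1' : a * k^-1 + 4 != 0.
  by apply: contra a1 => /eqP h; rewrite -(mulIr_eq0 _ (mulIf (invr_neq0 k0))) mulrDl mulfK // h.
have a2' : (a - 1) * k^-1 + 4 != 0.
  by apply: contra a2 => /eqP h; rewrite -(mulIr_eq0 _ (mulIf (invr_neq0 k0))) mulrDl mulfK // h.
by field; rewrite ?k0 ?a1 ?a2 ?a3 ?a1' ?a2'.
Qed.

End SecondMoment.

(** * Comparison of the shifted terms with those for zero parameters *)

Section Comparison.
Variable R : realType.
Local Notation C := (Cplx R).
Implicit Types (z w u : C) (x y e : R).

(** The share of the pair [z, w] in the modulus of [dterm]. With conjugate parameters both pairs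
    have the same share, so the term is a square. *)
Definition dpair z w n (l : int) : R :=
  nrm (invGamma (z + n%:R - l%:~R + 1) * invGamma (w + n%:R + l%:~R + 1)) *
  n%:R `^ complex.Re (z + w).

Lemma dscale_real n : dscale R n = ofreal (nrm (dscale R n)).
Proof.
rewrite /dscale nrmM nrmV nrmX !nrm_nat ofrealM ofrealV ofreal_nat.
by rewrite -[in RHS]natrX ofreal_nat natrX.
Qed.

Lemma dscale_gt0 n : 0 < nrm (dscale R n).
Proof.
by rewrite nrm_gt0 mulf_neq0 ?invr_neq0 ?expf_neq0 // fact_neq0.
Qed.

Lemma nrm_dterm z z' w w' n l : (0 < n)%N ->
  nrm (dterm z z' w w' n l) = dpair z w n l * dpair z' w' n l / nrm (dscale R n).
Proof.
move=> n0; rewrite /dterm /dweight /hterm /dpair nrmM.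
rewrite nrmM [nrm (natcpow _ _ / _)]nrmM nrmV nrm_natcpow //.
have -> : complex.Re (z + z' + w + w') = complex.Re (z + w) + complex.Re (z' + w').
  by rewrite !ReD; ring.
rewrite powRD ?pnatr_eq0 -?lt0n ?n0 ?implybT // !nrmM.
move: (nrm _) (nrm _) (nrm _) (nrm _) (nrm _) => a b c d e.
by ring.
Qed.

Lemma conj_int (l : int) : (l%:~R : C)^* = l%:~R.
Proof. exact: rmorph_int. Qed.

(* With conjugate parameters the terms are nonnegative reals, so that their
   moments are sums of absolute values. *)
Lemma dterm_conj z w n l : (0 < n)%N ->
  dterm z z^* w w^* n l = ofreal (dpair z w n l ^+ 2 / nrm (dscale R n)).
Proof.
move=> n0; rewrite /dterm /dweight /hterm.
have e1 : z^* + n%:R - l%:~R + 1 = (z + n%:R - l%:~R + 1)^*.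
  by rewrite 3!conjD conj_nat -mulrNz conj_int (conj_nat _ 1).
have e2 : w^* + n%:R + l%:~R + 1 = (w + n%:R + l%:~R + 1)^*.
  by rewrite 3!conjD conj_nat conj_int (conj_nat _ 1).
rewrite e1 e2 -!conj_invGamma.
have -> : natcpow n (z + z^* + w + w^*) = ofreal ((n%:R `^ complex.Re (z + w)) ^+ 2).
  have -> : z + z^* + w + w^* = (z + w) + (z + w)^* by rewrite conjD; ring.
  by rewrite natcpowD -conj_natcpow -sqr_nrm nrm_natcpow.
have H (x y p d : R) : ofreal (x * y * p / d)
    = ofreal x * ofreal y * ofreal p / ofreal d.
  by rewrite !ofrealM ofrealV.
rewrite /dpair exprMn nrmM exprMn H -dscale_real !sqr_nrm.
by rewrite !mulrA.
Qed.

(** The inequality between arithmetic and geometric means for the two [dpair] factors. It dominates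
    a general term by nonnegative ones, whose second moments are known. *)
Lemma nrm_dterm_le z z' w w' n l : (0 < n)%N ->
  nrm (dterm z z' w w' n l) <=
    2^-1 * (nrm (dterm z z^* w w^* n l) + nrm (dterm z' z'^* w' w'^* n l)).
Proof.
move=> n0; rewrite nrm_dterm // !dterm_conj // !nrm_ofreal.
have d0 := dscale_gt0 n.
move: (dpair z w n l) (dpair z' w' n l) (nrm _) d0 => x y d d0.
have d0' := ltW d0.
rewrite !ger0_norm ?divr_ge0 ?sqr_ge0 // -mulrDl mulrA ler_pM2r ?invr_gt0 //.
have := sqr_ge0 (x - y); rewrite sqrrB; lra.
Qed.

Lemma stirling_ratio0 k : stirling_ratio k (0 : C) = 1.
Proof.
by rewrite /stirling_ratio add0r invGamma_nat natcpow0 mulr1 mulVf ?fact_neq0.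
Qed.

Lemma stirling_ok0 : stirling_ok (0 : C).
Proof.
rewrite /stirling_ok (_ : (fun k => _) = fun=> 1); first exact: cvg_cst.
by apply/funext => k; rewrite stirling_ratio0.
Qed.

(* For [|l| << n] every factor in front of [dterm 0 0 0 0 n l] is close to 1. *)
Lemma dterm_bulk z z' w w' n l (k1 k2 : nat) : (0 < k1)%N -> (0 < k2)%N ->
  k1%:Z = n%:Z - l -> k2%:Z = n%:Z + l ->
  dterm z z' w w' n l =
    stirling_ratio k1 z * stirling_ratio k1 z' * stirling_ratio k2 w *
    stirling_ratio k2 w' *
    (natcpow n (z + z' + w + w') /
       (natcpow k1 (z + z') * natcpow k2 (w + w'))) *
    dterm 0 0 0 0 n l.
Proof.
move=> k10 k20 e1 e2.
have a1 u : u + n%:R - l%:~R + 1 = u + k1.+1%:R.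
  have -> : k1.+1%:R = n%:R - l%:~R + 1 :> C.
    by rewrite -natr1 -[k1%:R]/(k1%:Z%:~R) e1 rmorphB.
  by rewrite !addrA.
have a2 u : u + n%:R + l%:~R + 1 = u + k2.+1%:R.
  have -> : k2.+1%:R = n%:R + l%:~R + 1 :> C.
    by rewrite -natr1 -[k2%:R]/(k2%:Z%:~R) e2 rmorphD.
  by rewrite !addrA.
rewrite /dterm /dweight /hterm !a1 !a2 !add0r !invGamma_nat natcpow0.
rewrite /stirling_ratio !natcpowD.
have := fact_neq0 R k1; have := fact_neq0 R k2.
have := natcpow_neq0 k1 z; have := natcpow_neq0 k1 z'.
have := natcpow_neq0 k2 w; have := natcpow_neq0 k2 w'.
have d0 : dscale R n != 0 by rewrite -nrm_gt0 dscale_gt0.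
move: (dscale R n) d0 => d d0 p1 p2 p3 p4 p5 p6.
by field; rewrite d0 p1 p2 p3 p4 p5 p6.
Qed.

Lemma near1M (a b : R) u z : b <= 1 -> nrm (u - 1) <= a -> nrm (z - 1) <= b ->
  nrm (u * z - 1) <= 2 * a + b.
Proof.
move=> b1 ha hb; have -> : u * z - 1 = (u - 1) * z + (z - 1) by ring.
rewrite (le_trans (nrmD _ _)) // lerD // nrmM mulrC ler_pM ?nrm_ge0 //.
rewrite -[z](subrK 1) (le_trans (nrmD _ _)) // nrm1 -[leRHS]/(1 + 1) lerD2r.
exact: le_trans hb b1.
Qed.

Lemma ln_near1 (x d : R) : d <= 2^-1 -> `|x - 1| <= d -> `|ln x| <= 2 * d.
Proof.
move=> d2; rewrite ler_norml => /andP[h1 h2].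
have x0 : 2^-1 <= x by lra.
have x0' : 0 < x by lra.
have l1 : ln x <= x - 1.
  by have := expR_ge1Dx (ln x); rewrite lnK ?posrE //; lra.
have l2 : - ln x <= x^-1 - 1.
  by have := expR_ge1Dx (- ln x); rewrite expRN lnK ?posrE //; lra.
have l3 : x^-1 - 1 <= 2 * d.
  rewrite lerBlDr -div1r ler_pdivrMr //; nra.
by rewrite ler_norml; apply/andP; split; lra.
Qed.

Lemma natcpow_ratio_near1 z w (n k1 k2 : nat) (d : R) :
  (0 < n)%N -> (0 < k1)%N -> (0 < k2)%N -> d <= 2^-1 ->
  `|k1%:R / n%:R - 1| <= d -> `|k2%:R / n%:R - 1| <= d ->
  2 * d * (nrm z + nrm w) <= 2^-1 ->
  nrm (natcpow n (z + w) / (natcpow k1 z * natcpow k2 w) - 1)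
    <= 6 * d * (nrm z + nrm w).
Proof.
move=> n0 k10 k20 d2 h1 h2 h3.
have lnd k : (0 < k)%N -> ln (k%:R / n%:R : R) = ln k%:R - ln n%:R.
  by move=> k0; rewrite ln_div ?posrE ?ltr0n.
have := ln_near1 d2 h1; have := ln_near1 d2 h2.
rewrite !lnd // => b2 b1.
set u := - (ofreal (ln k1%:R - ln n%:R) * z) - ofreal (ln k2%:R - ln n%:R) * w.
have -> : natcpow n (z + w) / (natcpow k1 z * natcpow k2 w) = cexp u.
  rewrite invfM -!natcpowN mulrA /natcpow -!cexpD /u !ofrealD !ofrealN.
  by congr cexp; ring.
have nu : nrm u <= 2 * d * (nrm z + nrm w).
  rewrite (le_trans (nrmD _ _)) // !nrmN !nrmM !nrm_ofreal mulrDr.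
  by rewrite lerD // ler_wpM2r ?nrm_ge0.
have hu := le_trans nu h3.
have := cexp_taylor1 hu => hc.
have -> : cexp u - 1 = (cexp u - 1 - u) + u by ring.
rewrite (le_trans (nrmD _ _)) // (le_trans (lerD hc (lexx _))) //.
(* As [|u| <= 1/2], the sum [4 |u|^2 + |u|] is at most [3 |u|]; the bound on [|u|] doubles this to
   the constant 6. *)
have := nrm_ge0 u; nra.
Qed.

Lemma bulk_indices (m1 m2 m3 m4 n : nat) (l : int) :
  (2 * (m1 + m2 + m3 + m4 + 1) <= n)%N -> (2 * `|l| <= n)%N ->
  exists k1 k2 : nat, [/\ k1%:Z = n%:Z - l, k2%:Z = n%:Z + l,
    [/\ (0 < n)%N, (0 < k1)%N & (0 < k2)%N] &
    [/\ (m1 <= k1)%N, (m2 <= k1)%N, (m3 <= k2)%N & (m4 <= k2)%N]].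
Proof.
move=> h1 h2; exists (absz (n%:Z - l)), (absz (n%:Z + l)).
by split; [lia | lia | split; lia | split; lia].
Qed.

Lemma dterm_compare z z' w w' e : stirling_ok z -> stirling_ok z' ->
  stirling_ok w -> stirling_ok w' -> 0 < e ->
  exists2 d : R, 0 < d & exists n0 : nat, forall n (l : int), (n0 <= n)%N ->
    `|l%:~R| <= d * n%:R ->
    nrm (dterm z z' w w' n l - dterm 0 0 0 0 n l) <= e * nrm (dterm 0 0 0 0 n l).
Proof.
move=> hz hz' hw hw' e0.
(* Five factors lie within [h] of 1: four Stirling ratios and the power ratio. By [near1M] the error
   of the product grows as [h, 3h, 7h, 15h, 31h]. *)
pose h : R := Num.min (e / 31) 1.
have h0 : 0 < h by rewrite lt_min ltr01 divr_gt0.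
have h1 : h <= 1 by rewrite ge_min lexx orbT.
have he : 31 * h <= e by rewrite -ler_pdivlMl // mulrC ge_min lexx.
pose M : R := nrm (z + z') + nrm (w + w') + 1.
have M0 : 0 < M by rewrite ltr_wpDl // addr_ge0 ?nrm_ge0.
pose d : R := Num.min 2^-1 (h / (12 * M)).
have d0 : 0 < d by rewrite lt_min invr_gt0 ltr0n divr_gt0 // mulr_gt0.
have d2 : d <= 2^-1 by rewrite ge_min lexx.
have dM : 12 * d * M <= h.
  by rewrite mulrAC mulrC -ler_pdivlMr ?mulr_gt0 // ge_min lexx orbT.
have st u : stirling_ok u -> exists m, forall k, (m <= k)%N ->
    nrm (stirling_ratio k u - 1) <= h.
  move=> /cvg_nrmP/cvgr0Pnorm_lt/(_ _ h0)[m _ hm]; exists m => k /hm.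
  by rewrite ger0_norm ?nrm_ge0 // => /ltW.
have [m1 s1] := st _ hz; have [m2 s2] := st _ hz'.
have [m3 s3] := st _ hw; have [m4 s4] := st _ hw'.
exists d => //; exists (2 * (m1 + m2 + m3 + m4 + 1))%N => n l nn ln.
have ln2 : `|l%:~R| <= n%:R / 2 :> R.
  by rewrite (le_trans ln) // mulrC ler_wpM2l.
have ln2' : (2 * `|l| <= n)%N.
  rewrite -(ler_nat R) natrM mulrC -ler_pdivlMr //.
  by rewrite natr_absz intr_norm.
have [k1 [k2 [e1 e2 [n0 k10 k20] [le1 le2 le3 le4]]]] := bulk_indices nn ln2'.
have n0' : (0 : R) < n%:R by rewrite ltr0n.
have r1 : `|k1%:R / n%:R - 1| <= d.
  have -> : k1%:R / n%:R - 1 = - l%:~R / n%:R :> R.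
    rewrite -[k1%:R]/(k1%:Z%:~R) e1 rmorphB /=.
    by field; rewrite gt_eqF.
  by rewrite normrM normrN normfV normr_nat ler_pdivrMr.
have r2 : `|k2%:R / n%:R - 1| <= d.
  have -> : k2%:R / n%:R - 1 = l%:~R / n%:R :> R.
    rewrite -[k2%:R]/(k2%:Z%:~R) e2 rmorphD /=.
    by field; rewrite gt_eqF.
  by rewrite normrM normfV normr_nat ler_pdivrMr.
rewrite (dterm_bulk z z' w w' k10 k20 e1 e2).
set D := dterm 0 0 0 0 n l.
set Q := natcpow n _ / _.
have hQ : nrm (Q - 1) <= h.
  rewrite /Q -addrA; have := @natcpow_ratio_near1 (z + z') (w + w') n k1 k2 d n0 k10 k20.
  rewrite addrA; move=> hh; apply: le_trans (hh d2 r1 r2 _) _.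
    by rewrite /M in dM; nra.
  by rewrite /M in dM; nra.
have -> : forall u, u * D - D = (u - 1) * D by move=> u; ring.
rewrite nrmM ler_wpM2r ?nrm_ge0 // (le_trans _ he) //.
have -> : 31 * h = 2 * (2 * (2 * (2 * h + h) + h) + h) + h by ring.
apply: near1M => //; apply: near1M => //; last exact: s4.
apply: near1M => //; last exact: s3.
by apply: near1M => //; [exact: s1 | exact: s2].
Qed.

End Comparison.

(** * Concentration of the terms and the proof of Dougall's formula *)

Section DougallFormula.
Variable R : realType.
Local Notation C := (Cplx R).
Implicit Types (z w u : C) (x y e : R).

Lemma cvg_mulr_cst (c : C) (f : nat -> C) (l : C) :
  f n @[n --> \oo] --> l -> c * f n @[n --> \oo] --> c * l.
Proof. by move=> h; apply: cvgM; [exact: cvg_cst | exact: h]. Qed.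
Arguments cvg_mulr_cst c {f l} _.

Lemma cvg_nrm_seq (f : nat -> C) (l : C) :
  f n @[n --> \oo] --> l -> nrm (f n) @[n --> \oo] --> nrm l.
Proof. exact: cvg_nrm. Qed.

Definition dmoment z z' w w' n : C :=
  moment_factor (z + n%:R) (z' + n%:R) (w + n%:R) (w' + n%:R) *
  (dougall_quotient z z' w w' * dnorm z z' w w' n).

Lemma cvg_dmoment z z' w w' n : 0 <= complex.Re z -> 0 <= complex.Re z' ->
  0 <= complex.Re w -> 0 <= complex.Re w' -> (0 < n)%N ->
  bsum (fun l => l%:~R ^+ 2 * dterm z z' w w' n l) B @[B --> \oo] -->
    dmoment z z' w w' n.
Proof.
move=> h1 h2 h3 h4 n0.
rewrite /dmoment -dweight_hsum // mulrCA.
have h : 1 < complex.Re (z + n%:R + (z' + n%:R) + (w + n%:R) + (w' + n%:R)).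
  have : (1 : R) <= n%:R by rewrite ler1n.
  by rewrite !ReD Re_nat; lra.
have {h} := cvg_mulr_cst (dweight z z' w w' n) (cvg_second_moment h).
apply: cvg_trans; apply: near_eq_cvg; apply: nearW => B.
rewrite -bsumM; apply: eq_bsum => l; rewrite /dterm.
move: (hterm _ _ _ _ _) (dweight _ _ _ _ _) => a b; ring.
Qed.

Lemma cvg_dmoment_scaled z z' w w' : stirling_ok (z + w) -> stirling_ok (z + w') ->
  stirling_ok (z' + w) -> stirling_ok (z' + w') ->
  stirling_ok (z + z' + w + w') -> 0 <= complex.Re (z + z' + w + w') ->
  nrm (dmoment z z' w w' n.+1) / n.+1%:R ^+ 2 @[n --> \oo] --> (0 : R).
Proof.
move=> h1 h2 h3 h4 h5 a0.
have d1 : (fun n => dnorm z z' w w' n.+1) @ \oo --> (1 : C).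
  by rewrite -(cvg_comp_succ (dnorm z z' w w')); exact: cvg_dnorm.
have h : (fun n => moment_factor (z + n.+1%:R) (z' + n.+1%:R) (w + n.+1%:R)
    (w' + n.+1%:R) / n.+1%:R ^+ 2 * (dougall_quotient z z' w w' * dnorm z z' w w' n.+1))
    @ \oo --> 0 * (dougall_quotient z z' w w' * 1).
  by apply: cvgM; [exact: cvg_moment_factor | exact: cvg_mulr_cst].
rewrite mul0r in h; have {h} := cvg_nrm_seq h; rewrite nrm0.
apply: cvg_trans; apply: near_eq_cvg; apply: nearW => n.
rewrite /dmoment /= !nrmM nrmV nrmX nrm_nat.
by move: (nrm _) (nrm _) (nrm _) => a b c; rewrite -!mulrA; congr (_ * _); ring.
Qed.

Lemma bsum_nrm_real (v : int -> C) (f : int -> R) B :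
  (forall l, 0 <= f l) -> (forall l, v l = ofreal (f l)) ->
  bsum f B = nrm (bsum v B).
Proof.
move=> f0 vf.
have h : bsum v B = ofreal (bsum f B).
  elim: B => [|B IH]; first by rewrite /bsum !big_ord0 !addr0 vf.
  by rewrite !bsumS IH !vf !ofrealD.
rewrite h nrm_ofreal ger0_norm //.
by rewrite addr_ge0 // sumr_ge0 // => i _; rewrite addr_ge0.
Qed.

Lemma dterm_conj_real z w n l : (0 < n)%N ->
  dterm z z^* w w^* n l = ofreal (nrm (dterm z z^* w w^* n l)).
Proof.
move=> n0; rewrite dterm_conj // nrm_ofreal ger0_norm // divr_ge0 ?sqr_ge0 //.
exact: nrm_ge0.
Qed.

Lemma cvg_dmoment_conj z w n : 0 <= complex.Re z -> 0 <= complex.Re w ->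
  (0 < n)%N ->
  bsum (fun l => l%:~R ^+ 2 * nrm (dterm z z^* w w^* n l)) B @[B --> \oo] -->
    nrm (dmoment z z^* w w^* n).
Proof.
move=> h1 h2 n0.
have h : bsum (fun l => l%:~R ^+ 2 * dterm z z^* w w^* n l) B @[B --> \oo] -->
    dmoment z z^* w w^* n.
  by apply: cvg_dmoment; rewrite ?Re_conjc.
have {h} := cvg_nrm_seq h; apply: cvg_trans; apply: near_eq_cvg; apply: nearW => B.
apply/esym/bsum_nrm_real => l; first by rewrite mulr_ge0 ?sqr_ge0 ?nrm_ge0.
rewrite [in LHS]dterm_conj_real // ofrealM; congr (_ * _).
by rewrite -[l%:~R](rmorph_int (real_complex R)) -rmorphXn.
Qed.

Lemma dougall_quotient0 : dougall_quotient (0 : C) 0 0 0 = 1.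
Proof.
rewrite /dougall_quotient /dougall_lhs /dougall_rhs hsum0 !add0r invGamma1.
by rewrite !mulr1 invr1 mulr1.
Qed.

Lemma stirling_ok_Re z : 0 < complex.Re z -> stirling_ok z.
Proof. exact: cvg_stirling_ratio. Qed.

(* Chebyshev's inequality: the terms with [|l| > d n] carry a vanishing share
   of the mass, because the second moment is [o(n^2)]. *)
Lemma dterm_chebyshev z z' w w' e : 0 < complex.Re z -> 0 < complex.Re z' ->
  0 < complex.Re w -> 0 < complex.Re w' -> 0 < e ->
  exists c : R, exists n0 : nat, forall n l, (n0 <= n)%N ->
  nrm (dterm z z' w w' n.+1 l - dterm 0 0 0 0 n.+1 l) <=
    e * nrm (dterm 0 0 0 0 n.+1 l) +
    c / n.+1%:R ^+ 2 * (l%:~R ^+ 2 * nrm (dterm z z^* w w^* n.+1 l) +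
      l%:~R ^+ 2 * nrm (dterm z' z'^* w' w'^* n.+1 l) +
      l%:~R ^+ 2 * nrm (dterm 0 0 0 0 n.+1 l)).
Proof.
move=> h1 h2 h3 h4 e0.
have [d d0 [n0 hn]] := dterm_compare (stirling_ok_Re h1) (stirling_ok_Re h2)
  (stirling_ok_Re h3) (stirling_ok_Re h4) e0.
exists (d ^- 2), n0 => n l nn.
have hle := @nrm_dterm_le R z z' w w' n.+1 l isT.
have := hn n.+1 l (leqW nn).
move: (dterm z z' w w' _ _) (dterm 0 _ _ _ _ _) (dterm z z^* _ _ _ _)
  (dterm z' z'^* _ _ _ _) hle => P P0 P1 P2 hle hb.
have := nrm_ge0 P0; have := nrm_ge0 P1; have := nrm_ge0 P2 => p2 p1 p0.
have l2 : 0 <= l%:~R ^+ 2 :> R by exact: sqr_ge0.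
have n1 : (0 : R) < n.+1%:R by rewrite ltr0n.
have c0 : 0 <= d ^- 2 / n.+1%:R ^+ 2 by rewrite divr_ge0 ?invr_ge0 ?exprn_ge0 ?ltW.
rewrite -!mulrDr.
have [lel|gtl] := leP `|l%:~R : R| (d * n.+1%:R).
  rewrite (le_trans (hb lel)) // lerDl.
  exact: mulr_ge0 c0 (mulr_ge0 l2 (addr_ge0 (addr_ge0 p1 p2) p0)).
have big : 1 <= d ^- 2 / n.+1%:R ^+ 2 * l%:~R ^+ 2.
  rewrite -invfM -exprMn mulrC ler_pdivlMr ?exprn_gt0 ?mulr_gt0 // mul1r.
  rewrite -[leRHS]real_normK ?num_real // ler_sqr ?nnegrE; first exact: ltW.
    by rewrite ltW // mulr_gt0.
  exact: normr_ge0.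
rewrite mulrA (@le_trans _ _ (0 + 1 * (nrm P1 + nrm P2 + nrm P0))) //; last first.
  apply: lerD; first exact: mulr_ge0 (ltW e0) p0.
  exact: ler_wpM2r (addr_ge0 (addr_ge0 p1 p2) p0) _ _ big.
rewrite (le_trans (nrmD _ _)) // nrmN add0r mul1r lerD2r (le_trans hle) //.
lra.
Qed.

(** The bound of [dterm_chebyshev] is summed over [l], then [n] tends to infinity at fixed [e], and
    only then is [e] released: the constant [c] depends on [e], but its coefficient, the second
    moment over [n^2], vanishes in the limit. *)
Lemma dougall_quotient1 z z' w w' : 0 < complex.Re z -> 0 < complex.Re z' ->
  0 < complex.Re w -> 0 < complex.Re w' -> dougall_quotient z z' w w' = 1.
Proof.
move=> h1 h2 h3 h4; apply/eqP; rewrite -subr_eq0 -nrm_eq0; apply/eqP.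
have Re0 : (0 : R) <= complex.Re (0 : C) by [].
have w1 := ltW h1; have w2 := ltW h2; have w3 := ltW h3; have w4 := ltW h4.
set Q := dougall_quotient _ _ _ _.
apply/eqP; rewrite eq_le nrm_ge0 andbT; apply/ler_addgt0Pr => e e0; rewrite add0r.
have [c [n0 hn]] := dterm_chebyshev h1 h2 h3 h4 e0.
have conj0 : (0 : C)^* = 0 by exact: (conj_nat R 0).
pose V z w n := nrm (dmoment z z^* w w^* n.+1) : R.
have step n : (n0 <= n)%N ->
   nrm (Q * dnorm z z' w w' n.+1 - dnorm (0 : C) 0 0 0 n.+1) <=
   e * nrm (dnorm (0 : C) 0 0 0 n.+1) +
   c / n.+1%:R ^+ 2 * (V z w n + V z' w' n + V 0 0 n).
  move=> nn.
  have lim1 : (fun B => nrm (bsum (dterm z z' w w' n.+1) B - bsum (dterm 0 0 0 0 n.+1) B))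
     @ \oo --> nrm (Q * dnorm z z' w w' n.+1 - dnorm (0 : C) 0 0 0 n.+1).
    apply: cvg_nrm; apply: cvgB; first exact: cvg_dterm.
    rewrite -[dnorm 0 _ _ _ _]mul1r -[X in X * _]dougall_quotient0.
    exact: cvg_dterm.
  (* For zero parameters the terms are nonnegative reals, so the sum of moduli is the modulus of the
     sum. *)
  have lim0 : (fun B => bsum (fun l => nrm (dterm (0 : C) 0 0 0 n.+1 l)) B) @ \oo -->
      nrm (dnorm (0 : C) 0 0 0 n.+1).
    have h : bsum (dterm (0 : C) 0 0 0 n.+1) B @[B --> \oo] --> dnorm (0 : C) 0 0 0 n.+1.
      rewrite -[dnorm 0 _ _ _ _]mul1r -[X in X * _]dougall_quotient0.
      exact: cvg_dterm.
    have {h} := cvg_nrm_seq h; apply: cvg_trans; apply: near_eq_cvg; apply: nearW => B.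
    apply/esym/bsum_nrm_real => l; first exact: nrm_ge0.
    by have := @dterm_conj_real 0 0 n.+1 l isT; rewrite conj0.
  have limV u v : 0 <= complex.Re u -> 0 <= complex.Re v ->
     bsum (fun l => l%:~R ^+ 2 * nrm (dterm u u^* v v^* n.+1 l)) B @[B --> \oo] --> V u v n.
    by move=> hu hv; exact: cvg_dmoment_conj.
  have lim00 := limV 0 0 Re0 Re0; rewrite conj0 in lim00.
  have lim2 : (fun B => e * bsum (fun l => nrm (dterm (0 : C) 0 0 0 n.+1 l)) B +
      c / n.+1%:R ^+ 2 *
      (bsum (fun l => l%:~R ^+ 2 * nrm (dterm z z^* w w^* n.+1 l)) B +
       bsum (fun l => l%:~R ^+ 2 * nrm (dterm z' z'^* w' w'^* n.+1 l)) B +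
       bsum (fun l => l%:~R ^+ 2 * nrm (dterm (0 : C) 0 0 0 n.+1 l)) B)) @ \oo -->
      e * nrm (dnorm (0 : C) 0 0 0 n.+1) +
      c / n.+1%:R ^+ 2 * (V z w n + V z' w' n + V 0 0 n).
    apply: cvgD; first by apply: cvgM; [exact: cvg_cst | exact: lim0].
    apply: cvgM; first exact: cvg_cst.
    by apply: cvgD; [apply: cvgD; exact: limV | exact: lim00].
  apply: (ler_cvg_to lim1 lim2); apply: nearW => B /=.
  rewrite -bsumN -bsumD (le_trans (nrm_bsum _ _)) //.
  rewrite -!bsumD -!bsumM -bsumD; apply: ler_bsum => l.
  exact: hn.
have s u : 0 < complex.Re u -> stirling_ok u by exact: stirling_ok_Re.
have limV0 u v : 0 < complex.Re u -> 0 < complex.Re v ->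
    (fun n => V u v n / n.+1%:R ^+ 2) @ \oo --> (0 : R).
  move=> hu hv; apply: cvg_dmoment_scaled; try apply: s;
    rewrite !ReD ?Re_conjc; lra.
have limV00 : (fun n => V 0 0 n / n.+1%:R ^+ 2) @ \oo --> (0 : R).
  have so := @stirling_ok0 R.
  by rewrite /V conj0; apply: cvg_dmoment_scaled; rewrite ?addr0.
have limn1 : (fun n => dnorm (0 : C) 0 0 0 n.+1) @ \oo --> (1 : C).
  rewrite -(cvg_comp_succ (dnorm (0 : C) 0 0 0)); have so := @stirling_ok0 R.
  by apply: cvg_dnorm; rewrite ?addr0.
have limn2 : (fun n => dnorm z z' w w' n.+1) @ \oo --> (1 : C).
  rewrite -(cvg_comp_succ (dnorm z z' w w')).
  by apply: cvg_dnorm; try apply: s; rewrite !ReD; lra.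
have lhs : (fun n => nrm (Q * dnorm z z' w w' n.+1 - dnorm (0 : C) 0 0 0 n.+1)) @ \oo
   --> nrm (Q - 1).
  have -> : nrm (Q - 1) = nrm (Q * 1 - 1) by rewrite mulr1.
  apply: cvg_nrm_seq; apply: cvgB; last exact: limn1.
  exact: cvg_mulr_cst limn2.
have rhs : (fun n => e * nrm (dnorm (0 : C) 0 0 0 n.+1) +
   c * (V z w n / n.+1%:R ^+ 2 + V z' w' n / n.+1%:R ^+ 2 + V 0 0 n / n.+1%:R ^+ 2)) @ \oo
   --> (e * 1 + c * (0 + 0 + 0)).
  apply: cvgD.
    apply: cvgM; first exact: cvg_cst.
    by rewrite -(nrm1 R); apply: cvg_nrm.
  apply: cvgM; first exact: cvg_cst.
  by apply: cvgD => //; apply: cvgD; apply: limV0.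
have := ler_cvg_to lhs rhs.
rewrite !addr0 mulr0 addr0 mulr1; apply.
exists n0 => // n /= nn; apply: le_trans (step n nn) _.
rewrite lerD2l -!mulrDl mulrA mulrAC; exact: lexx.
Qed.

(** A shift by [M + 1] makes all four real parts positive, where the quotient is 1; the equality
    returns to the original parameters through the common factor [c], even if [c] is 0. *)
Lemma dougall z z' w w' : -1 < complex.Re (z + z' + w + w') ->
  invGamma (z + z' + w + w' + 1) * hsum z z' w w' =
    invGamma (z + w + 1) * invGamma (z + w' + 1) *
    invGamma (z' + w + 1) * invGamma (z' + w' + 1).
Proof.
move=> a1; have [M [b1 b2 b3 b4]] := nat_bound4 z z' w w'.
have [c [/= e1 e2]] := dougall_shift M.+1 a1.
rewrite -[LHS]/(dougall_lhs z z' w w') -[RHS]/(dougall_rhs z z' w w') e1 e2.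
congr (_ * _).
have p u : nrm u <= M%:R -> 0 < complex.Re (u + M.+1%:R).
  move=> hu; have := le_trans (ler_Re_nrm u) hu.
  by rewrite ler_norml ReD Re_nat -natr1; lra.
have := dougall_quotient1 (p _ b1) (p _ b2) (p _ b3) (p _ b4).
have := dougall_rhs_neq0 (ltW (p _ b1)) (ltW (p _ b2)) (ltW (p _ b3)) (ltW (p _ b4)).
rewrite /dougall_quotient; move: (dougall_lhs _ _ _ _) (dougall_rhs _ _ _ _).
by move=> L L' L'0 /(canRL (divfK L'0)) ->; rewrite mul1r.
Qed.

End DougallFormula.

(** * Determinants of moments *)

Section Determinants.

(** The degree bound makes the matrix of coefficients triangular, and its product with the
    Vandermonde matrix is the given one. *)
Lemma det_polys (F : comNzRingType) N (P : 'I_N -> {poly F}) (x : 'I_N -> F) :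
  (forall i, (size (P i) <= i.+1)%N) ->
  \det (\matrix_(i, j) (P i).[x j])
    = \prod_i (P i)`_i * \prod_(i < N) \prod_(j < N | (i < j)%N) (x j - x i).
Proof.
move=> sP.
have -> : \matrix_(i, j) (P i).[x j]
    = \matrix_(i, k < N) (P i)`_k *m Vandermonde N (\row_j x j).
  apply/matrixP => i j; rewrite !mxE (horner_coef_wide _ (leq_trans (sP i) (ltn_ord i))).
  by apply: eq_bigr => k _; rewrite !mxE.
rewrite det_mulmx det_Vandermonde det_trig; last first.
  apply/is_trig_mxP => i j ij; rewrite mxE nth_default //.
  exact: leq_trans (sP i) ij.
congr (_ * _); first by apply: eq_bigr => i _; rewrite mxE.
by apply: eq_bigr => i _; apply: eq_bigr => j _; rewrite !mxE.
Qed.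

Lemma det_scale (F : comNzRingType) N (u v : 'I_N -> F) (A : 'M[F]_N) :
  \det (\matrix_(i, j) (u i * A i j * v j)) = \prod_i u i * \det A * \prod_i v i.
Proof.
have -> : \matrix_(i, j) (u i * A i j * v j)
    = diag_mx (\row_i u i) *m A *m diag_mx (\row_i v i).
  by apply/matrixP => i j; rewrite mxE mul_mx_diag mul_diag_mx !mxE.
rewrite !det_mulmx !det_diag.
by congr (_ * _ * _); apply: eq_bigr => i _; rewrite mxE.
Qed.

(** The sign of the reversal enters twice. The lemma turns entries whose parameters decrease with
    [i] and [j] into a Hankel matrix with increasing arguments. *)
Lemma det_rev (F : comNzRingType) N (A : 'M[F]_N) :
  \det (\matrix_(i, j) A (rev_ord i) (rev_ord j)) = \det A.
Proof.
pose s : 'S_N := perm rev_ord_inj.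
have -> : \matrix_(i, j) A (rev_ord i) (rev_ord j) = row_perm s (col_perm s A).
  by apply/matrixP => i j; rewrite !mxE !permE.
rewrite row_permE col_permE !det_mulmx !det_perm odd_permV.
by rewrite mulrCA mulrA -mulrA -signr_addb addbb mulr1.
Qed.

(** Both determinants are expanded over permutations [s] and [t]; for fixed [s, t] the sum over all
    maps [g] factors over the coordinates. Summing over [t] gives the same determinant for each [s],
    hence the multiplicity. *)
Lemma andreief (F : comNzRingType) N (T : finType) (p q : 'I_N -> T -> F) (f : T -> F) :
  \sum_(g : {ffun 'I_N -> T})
     \det (\matrix_(i, j) p i (g j)) * \det (\matrix_(i, j) q i (g j)) * \prod_j f (g j)
  = \det (\matrix_(i, j) \sum_t p i t * q j t * f t) *+ #|{: 'S_N}|.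
Proof.
pose M := \matrix_(i, j) \sum_t p i t * q j t * f t.
have detE (r : 'I_N -> T -> F) (g : {ffun 'I_N -> T}) :
    \det (\matrix_(i, j) r i (g j)) = \sum_(s : 'S_N) (-1) ^+ s * \prod_j r (s j) (g j).
  rewrite -det_tr; apply: eq_bigr => s _; congr (_ * _).
  by apply: eq_bigr => j _; rewrite !mxE.
have -> : \det M *+ #|{: 'S_N}| = \sum_(s : 'S_N) \sum_(t : 'S_N)
    (-1) ^+ s * (-1) ^+ t * \prod_j M (s j) (t j).
  rewrite -sumr_const; apply: eq_bigr => s _.
  have : \det (row_perm s M) = (-1) ^+ s * \det M.
    by rewrite row_permE det_mulmx det_perm.
  move=> /(congr1 ( *%R ((-1) ^+ s))); rewrite mulrA -signr_addb addbb mul1r => <-.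
  rewrite big_distrr /=; apply: eq_bigr => t _; rewrite mulrA; congr (_ * _).
  by apply: eq_bigr => j _; rewrite !mxE.
transitivity (\sum_(g : {ffun 'I_N -> T}) \sum_(s : 'S_N) \sum_(t : 'S_N)
    (-1) ^+ s * (-1) ^+ t * \prod_j (p (s j) (g j) * q (t j) (g j) * f (g j))).
  apply: eq_bigr => g _; rewrite !detE -mulrA big_distrl /=; apply: eq_bigr => s _.
  rewrite big_distrl big_distrr /=; apply: eq_bigr => t _.
  have E (a b x y z : F) : a * x * (b * y * z) = a * b * (x * y * z) by ring.
  by rewrite E 2!big_split.
rewrite exchange_big; apply: eq_bigr => s _; rewrite exchange_big /=.
apply: eq_bigr => t _; rewrite -big_distrr /=; congr (_ * _).
under [RHS]eq_bigr do rewrite mxE.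
by rewrite (bigA_distr_bigA (fun j u => p (s j) u * q (t j) u * f u)).
Qed.

Definition decreasing_ffun N m (g : {ffun 'I_N -> 'I_m}) : bool :=
  [forall i : 'I_N, forall j : 'I_N, (i < j)%N ==> (g j < g i)%N].

Lemma decreasing_ffunP N m (g : {ffun 'I_N -> 'I_m}) :
  reflect (forall i j : 'I_N, (i < j)%N -> (g j < g i)%N) (decreasing_ffun g).
Proof.
apply: (iffP forallP) => h i; first by move=> j ij; exact: (implyP (forallP (h i) j)).
by apply/forallP => j; apply/implyP; exact: h.
Qed.

Definition ffun_perm N m (g : {ffun 'I_N -> 'I_m}) (s : 'S_N) : {ffun 'I_N -> 'I_m} :=
  [ffun i => g (s i)].

(** The rank of [i] is the number of indices with a larger value. Injectivity of [g] makes the rank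
    a permutation, and [s] sorts [g] precisely when [s i] has rank [i]. *)
Lemma unique_sorting_perm N m (g : {ffun 'I_N -> 'I_m}) : injective g ->
  exists s0, forall s, decreasing_ffun (ffun_perm g s) = (s == s0).
Proof.
move=> gI.
pose rk i := #|[set j : 'I_N | (g i < g j)%N]%SET|.
have rk_lt i : (rk i < N)%N.
  rewrite -[X in (_ < X)%N]card_ord -cardsT; apply: proper_card; apply/properP.
  by split; [exact: finset.subsetT | exists i; rewrite ?inE // ltnn].
have rk_anti i j : (g i < g j)%N -> (rk j < rk i)%N.
  move=> gij; apply: proper_card; apply/properP; split.
    by apply/fintype.subsetP => k; rewrite !inE; exact: ltn_trans.
  by exists j; rewrite !inE ?gij // ltnn.
pose r i := Ordinal (rk_lt i).
have rI : injective r.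
  move=> i j /(congr1 val) /= rij; apply: gI; apply/val_inj.
  by have [/rk_anti|/rk_anti|//] := ltngtP (g i) (g j); rewrite rij ltnn.
exists (perm rI)^-1%g => s; apply/idP/eqP.
  move=> /decreasing_ffunP h.
  apply/permP => i; apply: (@perm_inj _ (perm rI)); rewrite permKV permE.
  apply/val_inj; rewrite /= /rk.
  have -> : [set j : 'I_N | (g (s i) < g j)%N]%SET = (s @: [set k : 'I_N | (k < i)%N])%SET.
    apply/finset.setP => j; rewrite inE -[j in LHS](permKV s).
    rewrite -[j in RHS](permKV s) (mem_imset _ _ perm_inj) inE.
    set k := (s^-1)%g j; apply/idP/idP => [gk|/h]; last by rewrite !ffunE.
    have [//|/h|/val_inj e] := ltngtP k i; last by rewrite e ltnn in gk.
    by rewrite !ffunE ltnNge (ltnW gk).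
  rewrite card_imset; last exact: perm_inj.
  rewrite -sum1_card; under eq_bigl do rewrite inE.
  rewrite -(big_ord_widen_cond N xpredT (fun=> 1%N)) 1?ltnW //.
  by rewrite sum1_card card_ord.
move=> ->; apply/decreasing_ffunP => i j ij; rewrite !ffunE.
set i' := _ i; set j' := _ j.
have ri : rk i' = i by have := permKV (perm rI) i; rewrite permE => /(congr1 val).
have rj : rk j' = j by have := permKV (perm rI) j; rewrite permE => /(congr1 val).
have [//|/rk_anti|/val_inj/gI e] := ltngtP (g j') (g i').
  by rewrite ri rj ltnNge ltnW.
by move: ij; rewrite -ri -rj e ltnn.
Qed.

(** Double counting of pairs [(g, s)] with [ffun_perm g s] decreasing: an injective [g] has exactly
    one such [s]. *)
Lemma sum_decreasing (F : comNzRingType) N m (W : {ffun 'I_N -> 'I_m} -> F) :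
  (forall g s, W (ffun_perm g s) = W g) ->
  (forall g : {ffun 'I_N -> 'I_m}, ~ injective g -> W g = 0) ->
  \sum_g W g = (\sum_(g | decreasing_ffun g) W g) *+ #|{: 'S_N}|.
Proof.
move=> Ws W0.
transitivity (\sum_g \sum_(s : 'S_N | decreasing_ffun (ffun_perm g s)) W g).
  apply: eq_bigr => g _; have [gI|gI] := pselect (injective g).
    have [s0 h] := unique_sorting_perm gI.
    by rewrite (eq_bigl (pred1 s0)) ?big_pred1_eq // => s; rewrite h.
  by rewrite W0 // big1.
rewrite (exchange_big_dep xpredT) //= -sumr_const; apply: eq_bigr => s _.
pose h (g : {ffun 'I_N -> 'I_m}) := ffun_perm g s.
have hK : cancel h (fun g => ffun_perm g s^-1%g).
  by move=> g; apply/ffunP => i; rewrite !ffunE permKV.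
have hK' : cancel (fun g => ffun_perm g s^-1%g) h.
  by move=> g; apply/ffunP => i; rewrite !ffunE permK.
rewrite [RHS](reindex h); last by exists (fun g => ffun_perm g s^-1%g) => g _.
by apply: eq_bigr => g _; rewrite Ws.
Qed.

Lemma prod_ord_diff (F : comNzRingType) N :
  \prod_(i < N) \prod_(j < N | (i < j)%N) (j%:R - i%:R : F) = \prod_(j < N) j`!%:R.
Proof.
rewrite (exchange_big_dep xpredT) //=; apply: eq_bigr => j _.
rewrite -(big_ord_widen_cond N xpredT (fun i => j%:R - i%:R : F)) 1?ltnW //.
rewrite fact_prod natr_prod big_add1 /= big_mkord (reindex_inj rev_ord_inj) /=.
apply: eq_bigr => i _; rewrite -natrB; last by rewrite leq_subr.
by congr (_%:R); have := ltn_ord i; lia.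
Qed.

End Determinants.

Section MomentDeterminant.

(** A permutation of the coordinates changes both determinants by the same sign, and a repeated
    value makes both vanish; so [sum_decreasing] applies, and its multiplicity cancels that of
    [andreief]. *)
Lemma andreief_decreasing (F : numFieldType) N m (p q : 'I_N -> 'I_m -> F) (f : 'I_m -> F) :
  \sum_(g : {ffun 'I_N -> 'I_m} | decreasing_ffun g)
     \det (\matrix_(i, j) p i (g j)) * \det (\matrix_(i, j) q i (g j)) * \prod_j f (g j)
  = \det (\matrix_(i, j) \sum_t p i t * q j t * f t).
Proof.
have c0 : (0 < #|{: 'S_N}|)%N by apply/card_gt0P; exists 1%g.
have c0' : #|{: 'S_N}|%:R != 0 :> F by rewrite pnatr_eq0 -lt0n.
apply: (mulIf c0'); rewrite !mulr_natr -andreief sum_decreasing // => [g s|g gI].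
  have perm_det (r : 'I_N -> 'I_m -> F) :
      \det (\matrix_(i, j) r i (ffun_perm g s j)) = \det (\matrix_(i, j) r i (g j)) * (-1) ^+ s.
    have -> : \matrix_(i, j) r i (ffun_perm g s j) = col_perm s (\matrix_(i, j) r i (g j)).
      by apply/matrixP => i j; rewrite !mxE ffunE.
    by rewrite col_permE det_mulmx det_perm odd_permV.
  rewrite !perm_det mulrACA -signr_addb addbb mulr1; congr (_ * _).
  rewrite [RHS](reindex_inj (@perm_inj _ s)) /=.
  by apply: eq_bigr => j _; rewrite ffunE.
have [i [j [ij gij]]] : exists i j, i != j /\ g i = g j.
  apply: contrapT => h; apply: gI => i j gij; apply/eqP; apply: contrapT => ij.
  by apply: h; exists i, j; split => //; apply/negP.
rewrite -[\det (\matrix_(i, j) p _ _)]det_tr (determinant_alternate ij) ?mul0r //.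
by move=> k; rewrite !mxE gij.
Qed.

Definition box_coord B (t : 'I_(B.*2).+1) : int := t%:Z - B%:Z.

Variable R : realType.
Local Notation C := (Cplx R).
Implicit Types (z w u : C) (x y e : R).

Definition vdm N (x : 'I_N -> int) : C :=
  \prod_(i < N) \prod_(j < N | (i < j)%N) ((x j)%:~R - (x i)%:~R).

Definition zw_term N z z' w w' (x : 'I_N -> int) : C :=
  vdm x ^+ 2 * \prod_i hterm (z - 1) (z' - 1) (w + N%:R) (w' + N%:R) (x i).

(** [mu] is a partial sum of Dougall's series or its limit, so that one matrix serves both sides of
    the passage to the limit. *)
Definition moment_matrix N z z' w w' (mu : C -> C -> C -> C -> C) : 'M[C]_N :=
  \matrix_(i, j) mu (z - 1 - i%:R) (z' - 1 - j%:R) (w + N%:R) (w' + N%:R).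

(* [zpoly z i] evaluates at [l] to the ratio of [hterm (z - i) z' w w' l] to
   [hterm z z' w w' l]; this is what makes the Vandermonde factors shift the
   parameters of the series. *)
Definition zpoly (c : C) (i : nat) : {poly C} :=
  (-1) ^+ i *: \prod_(k < i) ('X - (c - k%:R)%:P).

Lemma size_index_enum_ord i : size (index_enum 'I_i) = i.
Proof. by rewrite /index_enum -enumT size_enum_ord. Qed.

Lemma size_zpoly c i : (size (zpoly c i) <= i.+1)%N.
Proof.
rewrite (leq_trans (size_scale_leq _ _)) // size_prod_XsubC.
by rewrite size_index_enum_ord.
Qed.

Lemma coef_zpoly c i : (zpoly c i)`_i = (-1) ^+ i.
Proof.
rewrite coefZ.
have /monicP := monic_prod_XsubC (index_enum 'I_i) xpredT (fun k => c - k%:R : C).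
rewrite lead_coefE size_prod_XsubC /= size_index_enum_ord => ->.
by rewrite mulr1.
Qed.

Lemma horner_zpoly c i u : (zpoly c i).[u] = \prod_(k < i) (c - k%:R - u).
Proof.
rewrite hornerZ horner_prod; elim: i => [|i IH]; first by rewrite !big_ord0 mulr1.
rewrite !big_ord_recr /= -IH exprS hornerXsubC.
by move: (\prod_(_ < _) _) ((-1) ^+ i) => b d; ring.
Qed.

Lemma hterm_pred z z' w w' l :
  hterm (z - 1) z' w w' l = (z - l%:~R) * hterm z z' w w' l.
Proof.
rewrite /hterm ![_ - 1 - _ + 1]addrAC !subrK.
by rewrite (invGammaS (z - _)); ring.
Qed.

Lemma hterm_swap z z' w w' l : hterm z z' w w' l = hterm z' z w w' l.
Proof. by rewrite /hterm; ring. Qed.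

Lemma hterm_zpoly z z' w w' i l :
  hterm (z - i%:R) z' w w' l = (zpoly z i).[l%:~R] * hterm z z' w w' l.
Proof.
rewrite horner_zpoly; elim: i => [|i IH]; first by rewrite subr0 big_ord0 mul1r.
rewrite -natr1 opprD addrA hterm_pred IH big_ord_recr /=; ring.
Qed.

Lemma det_zpoly N c (x : 'I_N -> int) :
  \det (\matrix_(i < N, j < N) (zpoly c i).[(x j)%:~R])
    = \prod_(i < N) (-1) ^+ i * vdm x.
Proof.
rewrite (det_polys (fun j => (x j)%:~R) (fun i => size_zpoly c i)).
by congr (_ * _); apply: eq_bigr => i _; rewrite coef_zpoly.
Qed.

Lemma sum_zw_term_box N B z z' w w' :
  \sum_(g : {ffun 'I_N -> 'I_(B.*2).+1} | decreasing_ffun g)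
     zw_term z z' w w' (fun i => box_coord (g i))
  = \det (moment_matrix N z z' w w' (fun a b c d => bsum (hterm a b c d) B)).
Proof.
pose f t := hterm (z - 1) (z' - 1) (w + N%:R) (w' + N%:R) (@box_coord B t).
pose p c (i : 'I_N) (t : 'I_(B.*2).+1) := (zpoly c i).[(box_coord t)%:~R].
have -> : moment_matrix N z z' w w' (fun a b c d => bsum (hterm a b c d) B)
    = \matrix_(i, j) \sum_t p (z - 1) i t * p (z' - 1) j t * f t.
  apply/matrixP => i j; rewrite !mxE -bsum_ord; apply: eq_bigr => t _.
  rewrite -/(box_coord t) hterm_zpoly hterm_swap hterm_zpoly hterm_swap.
  by rewrite /p /f; ring.
rewrite -andreief_decreasing; apply: eq_bigr => g _.
rewrite /zw_term /p !(det_zpoly _ (fun j => box_coord (g j))); congr (_ * _).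
(* The signs [(-1)^i] of the two determinants square to 1. *)
rewrite mulrACA -big_split /= big1 ?mul1r ?expr2 // => i _.
by rewrite -expr2 sqrr_sign.
Qed.

Definition hpoly (j : nat) : {poly C} := \prod_(k < j) ('X - (- k%:R)%:P).

(** Once [Gamma (A + i)] is taken out of row [i], the entry is the rising factorial of length [j] at
    [A + i], a monic polynomial of degree [j]. What remains is a Vandermonde determinant with
    equally spaced nodes, that is, a product of factorials. *)
Lemma det_hankel_Gamma N (A : C) : 0 < complex.Re A ->
  \det (\matrix_(i < N, j < N) Gamma (A + (i + j)%:R))
   = \prod_(i < N) (Gamma (A + i%:R) * i`!%:R).
Proof.
move=> A0.
have HG (i j : nat) : Gamma (A + (i + j)%:R) = Gamma (A + i%:R) * (hpoly j).[A + i%:R].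
  have -> : (hpoly j).[A + i%:R] = poch (A + i%:R) j.
    by rewrite horner_prod; apply: eq_bigr => k _; rewrite hornerXsubC opprK.
  rewrite /Gamma (poch_invGamma (A + i%:R) j) natrD addrA.
  have p0 : poch (A + i%:R) j != 0.
    by apply: poch_neq0 => k _; rewrite -addrA -natrD Re_gt0_addn_neq0.
  by rewrite invfM mulrAC mulVf // mul1r.
have -> : \matrix_(i < N, j < N) Gamma (A + (i + j)%:R) =
   \matrix_(i, j) (Gamma (A + i%:R) *
      (\matrix_(i < N, j < N) (hpoly i).[A + j%:R])^T i j * 1).
  by apply/matrixP => i j; rewrite !mxE HG mulr1.
rewrite det_scale det_tr big1_eq mulr1 big_split /=; congr (_ * _).
rewrite (det_polys (fun j : 'I_N => A + j%:R)) => [|i]; last first.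
  by rewrite size_prod_XsubC size_index_enum_ord.
rewrite big1 => [|i _]; last first.
  have /monicP := monic_prod_XsubC (index_enum 'I_i) xpredT (fun k => - k%:R : C).
  by rewrite lead_coefE size_prod_XsubC /= size_index_enum_ord /hpoly => ->.
rewrite mul1r -prod_ord_diff; apply: eq_bigr => i _; apply: eq_bigr => j _.
by rewrite opprD addrACA subrr add0r.
Qed.

(** With rows and columns reversed, Dougall's formula makes the entry
    [U i * Gamma (a + 1 + i + j) * V j]. The Hankel determinant supplies [i!], while [S_] contains
    its inverse, hence the square of the factorials on the right. *)
Lemma det_moment_matrix N z z' w w' : -1 < complex.Re (z + z' + w + w') ->
  \det (moment_matrix N z z' w w' (@hsum R))
    = S_ N (z, z', w, w') * (\prod_(j < N) j`!%:R) ^+ 2.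
Proof.
move=> a1; set a := z + z' + w + w'.
pose U i : C := invGamma (z + w + i.+1%:R) * invGamma (z + w' + i.+1%:R).
pose V i : C := invGamma (z' + w + i.+1%:R) * invGamma (z' + w' + i.+1%:R).
rewrite -det_rev.
have -> : \matrix_(i, j) moment_matrix N z z' w w' (@hsum R) (rev_ord i) (rev_ord j)
  = \matrix_(i, j) (U i * (\matrix_(i < N, j < N) Gamma (a + 1 + (i + j)%:R)) i j * V j).
  apply/matrixP => i j; rewrite !mxE.
  have ri (k : 'I_N) : (rev_ord k)%:R = N%:R - 1 - k%:R :> C.
    by rewrite /= natrB // -natr1; ring.
  have d := @dougall _ (z - 1 - (rev_ord i)%:R) (z' - 1 - (rev_ord j)%:R) (w + N%:R) (w' + N%:R).
  rewrite !ri in d *.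
  have e1 u v (k : 'I_N) : u - 1 - (N%:R - 1 - k%:R) + (v + N%:R) + 1 = u + v + k.+1%:R :> C.
    by rewrite -natr1; ring.
  rewrite !e1 in d.
  have e2 : z - 1 - (N%:R - 1 - i%:R) + (z' - 1 - (N%:R - 1 - j%:R)) + (w + N%:R) + (w' + N%:R)
    = a + (i + j)%:R by rewrite natrD /a; ring.
  rewrite e2 [a + _ + 1]addrAC in d.
  have r0 : 0 <= (i + j)%:R :> R by [].
  have g0 : invGamma (a + 1 + (i + j)%:R) != 0.
    by apply: invGamma_Re_gt0; rewrite ReD [complex.Re (a + 1)]ReD Re1 Re_nat /a; lra.
  apply: (mulfI g0); rewrite d; last by rewrite ReD Re_nat /a; lra.
  by rewrite /U /V /Gamma; move: (invGamma (a + 1 + _)) g0 => G G0; field.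
rewrite det_scale det_hankel_Gamma; last by rewrite ReD Re1 /a; lra.
rewrite /S_ -/a big_add1 /= big_mkord -prodrXl -!big_split /=.
apply: eq_bigr => i _; rewrite invGamma_nat /U /V -(addrA a) nat1r.
have f0 := fact_neq0 R i.
by field.
Qed.

End MomentDeterminant.

(** * Sums over signatures *)

Section GelfandTsetlinBoxes.
Variable N : nat.
Implicit Types (l : GT N).

(* [lambda_i - i] with the paper's numbering of coordinates from 1. *)
Definition shifted l (i : 'I_N) : int := part l i - i.+1%:Z.

Lemma ge_int_trans : transitive (fun x y : int => y <= x).
Proof. by move=> y x z /= yx zy; exact: le_trans zy yx. Qed.

Lemma shifted_decreasing l (i j : 'I_N) : (i < j)%N -> shifted l j < shifted l i.
Proof.
move=> ij; rewrite /shifted /part.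
have h : tnth (val l) j <= tnth (val l) i.
  rewrite !(tnth_nth 0).
  apply: (sorted_leq_nth ge_int_trans (fun x => lexx x) 0 (valP l)) => //.
  - by rewrite inE size_tuple.
  - by rewrite inE size_tuple.
  - exact: ltnW.
by lia.
Qed.

Lemma shifted_inj : injective shifted.
Proof.
move=> l l' /funeqP e; apply/val_inj/eq_from_tnth => i.
by have := e i; rewrite /shifted /part; lia.
Qed.

Definition gt_tuple B (g : {ffun 'I_N -> 'I_(B.*2).+1}) : N.-tuple int :=
  [tuple box_coord (g i) + i.+1%:Z | i < N].

Lemma sorted_zero : sorted >=%R (nseq_tuple N (0 : int)).
Proof. by apply/(sortedP 0) => i; rewrite size_tuple !nth_nseq => h; rewrite h ltnW. Qed.

(** The zero signature is a default value, reached only when [g] is not decreasing. *)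
Definition gt_of B (g : {ffun 'I_N -> 'I_(B.*2).+1}) : GT N :=
  insubd (exist _ (nseq_tuple N (0 : int)) sorted_zero : GT N) (gt_tuple g).

Lemma shifted_gt_of B (g : {ffun 'I_N -> 'I_(B.*2).+1}) : decreasing_ffun g ->
  shifted (gt_of g) = fun i => box_coord (g i).
Proof.
move=> /decreasing_ffunP dg; apply/funext => i.
have s : sorted >=%R (gt_tuple g).
  apply/(sortedP 0) => k; rewrite size_tuple => kN.
  have k0 := ltnW kN.
  rewrite -(tnth_nth 0 _ (Ordinal k0)) -(tnth_nth 0 _ (Ordinal kN)) !tnth_mktuple.
  have := dg (Ordinal k0) (Ordinal kN) (ltnSn k); rewrite /box_coord /=.
  by lia.
by rewrite /shifted /part /gt_of val_insubd s tnth_mktuple; lia.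
Qed.

Definition gt_box B : {fset GT N} :=
  seq_fset tt [seq gt_of g | g <- enum (@decreasing_ffun N (B.*2).+1)].

Lemma gt_of_inj B : {in @decreasing_ffun N (B.*2).+1 &, injective (@gt_of B)}.
Proof.
move=> g g' dg dg' e; apply/ffunP => i; apply/val_inj.
have := congr1 (fun l => shifted l i) e.
by rewrite !shifted_gt_of // /box_coord /=; lia.
Qed.

Lemma sum_gt_box (V : zmodType) (F : GT N -> V) B :
  \sum_(l <- gt_box B) F l = \sum_(g | @decreasing_ffun N (B.*2).+1 g) F (gt_of g).
Proof.
have u : uniq [seq gt_of g | g <- enum (@decreasing_ffun N (B.*2).+1)].
  rewrite map_inj_in_uniq ?enum_uniq // => g g'; rewrite !mem_enum.
  exact: gt_of_inj.
by rewrite (perm_big _ (seq_fset_perm _ _)) undup_id // big_map big_enum.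
Qed.

Lemma in_gt_box l B : (l \in gt_box B) = [forall i, (`|shifted l i| <= B)%N].
Proof.
rewrite seq_fsetE; apply/mapP/forallP => [[g]|h].
  rewrite mem_enum => dg -> i; rewrite shifted_gt_of //.
  by case: (g i) => t ht; move: ht; rewrite /box_coord /= -addnn; lia.
pose g : {ffun 'I_N -> 'I_(B.*2).+1} := [ffun i => inord (absz (shifted l i + B%:Z))].
have gE i : box_coord (g i) = shifted l i.
  by have := h i; rewrite ffunE /box_coord => hi; rewrite inordK; lia.
have dg : decreasing_ffun g.
  apply/decreasing_ffunP => i j /(shifted_decreasing l).
  by rewrite -!gE /box_coord; lia.
exists g; first by rewrite mem_enum.
by apply: shifted_inj; rewrite shifted_gt_of //; apply/funext => i; rewrite gE.
Qed.

Lemma gt_box_mono B B' : (B <= B')%N -> (gt_box B `<=` gt_box B')%fset.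
Proof.
move=> BB'; apply/fsubsetP => l; rewrite !in_gt_box => /forallP h.
by apply/forallP => i; exact: leq_trans (h i) BB'.
Qed.

Lemma gt_box_cofinal (A : {fset GT N}) : exists B, (A `<=` gt_box B)%fset.
Proof.
exists (\max_(l <- A) \max_(i < N) `|shifted l i|)%N; apply/fsubsetP => l lA.
rewrite in_gt_box; apply/forallP => i.
rewrite (big_rem l lA) /= leq_max; apply/orP; left.
exact: (@leq_bigmax _ (fun i : 'I_N => absz (shifted l i)) i).
Qed.

Lemma partial_sumE (V : zmodType) (F : GT N -> V) (A : {fset GT N}) :
  partial_sum F A = \sum_(l <- A) F l.
Proof. by rewrite /partial_sum big_seq_fsetE. Qed.

Lemma sum_fsubset (V : zmodType) (F : GT N -> V) (A B : {fset GT N}) :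
  (A `<=` B)%fset ->
  \sum_(l <- B) F l = \sum_(l <- A) F l + \sum_(l <- (B `\` A)%fset) F l.
Proof.
move=> /fsetIidPr AB.
have congr1_big (X Y : {fset GT N}) : X = Y ->
    \sum_(l <- X) F l = \sum_(l <- Y) F l by move=> ->.
rewrite (big_fsetID _ (mem A)) /=; congr (_ + _).
  apply: congr1_big; rewrite -[in RHS]AB; apply/fsetP => l.
  by rewrite in_fsetI !finmap.inE.
by apply: congr1_big; apply/fsetP => l; rewrite in_fsetD !finmap.inE andbC.
Qed.

Variable R : realType.
Local Notation C := (Cplx R).

(** The finite set is enlarged to a box, and then the condition that the coordinates decrease is
    dropped: the sum over all maps is the [N]-th power of a one-dimensional sum. *)
Lemma sum_prod_gt_le (c : int -> R) (H : R) (A : {fset GT N}) :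
  (forall k, 0 <= c k) -> (forall B, bsum c B <= H) ->
  \sum_(l <- A) \prod_i c (shifted l i) <= H ^+ N.
Proof.
move=> c0 cH; have [B AB] := gt_box_cofinal A.
have p0 l : 0 <= \prod_i c (shifted l i) by apply: prodr_ge0.
apply: (@le_trans _ _ (\sum_(l <- gt_box B) \prod_i c (shifted l i))).
  by rewrite (sum_fsubset _ AB) lerDl sumr_ge0.
rewrite sum_gt_box.
under eq_bigr => g dg do rewrite shifted_gt_of //.
apply: (@le_trans _ _ (\sum_(g : {ffun 'I_N -> 'I_(B.*2).+1}) \prod_i c (box_coord (g i)))).
  rewrite [leRHS](bigID (@decreasing_ffun N (B.*2).+1)) /= lerDl sumr_ge0 // => g _.
  exact: prodr_ge0.
rewrite -(bigA_distr_bigA (fun _ t => c (box_coord t))) /= prodr_const card_ord.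
have b0 B' : 0 <= bsum c B'.
  by rewrite addr_ge0 // sumr_ge0 // => k _; rewrite addr_ge0.
by rewrite bsum_ord lerXn2r ?nnegrE // (le_trans (b0 0) (cH 0)).
Qed.

(** [A0] nearly attains the supremum of the finite sums. It is chosen from the majorant [h] alone,
    so it will serve all parameters in a compact set at once. *)
Lemma sum_fset_tail (h : GT N -> R) (H : R) : (forall l, 0 <= h l) ->
  (forall A : {fset GT N}, \sum_(l <- A) h l <= H) ->
  forall e, 0 < e -> exists A0 : {fset GT N}, forall A B : {fset GT N},
    (A0 `<=` A)%fset -> \sum_(l <- B) h l - \sum_(l <- A) h l < e.
Proof.
move=> h0 hH e e0; pose S : set R := [set \sum_(l <- A) h l | A in [set: {fset GT N}]].
have hs : has_sup S.
  split; first by exists (\sum_(l <- fset0) h l), fset0.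
  by exists H => _ [A _ <-].
have [_ [A0 _ <-] hA0] := sup_adherent e0 hs.
exists A0 => A B A0A.
have hB : \sum_(l <- B) h l <= sup S by apply: ub_le_sup; [exact: hs.2 | exists B].
have : \sum_(l <- A0) h l <= \sum_(l <- A) h l.
  by rewrite (sum_fsubset _ A0A) lerDl sumr_ge0.
by lra.
Qed.

Lemma Dim_sqr l : Dim R l ^+ 2 = vdm R (shifted l) ^+ 2 / (\prod_(j < N) j`!%:R) ^+ 2.
Proof.
have e : Dim R l ^+ 2 * (\prod_(j < N) j`!%:R) ^+ 2 = vdm R (shifted l) ^+ 2.
  rewrite -exprMn -prod_ord_diff /Dim -big_split /= /vdm -!prodrXl.
  apply: eq_bigr => i _; rewrite -big_split /= -!prodrXl; apply: eq_bigr => j ij.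
  have ji : (j%:Z - i%:Z)%:~R = j%:R - i%:R :> C by rewrite rmorphB.
  have ji0 : j%:R - i%:R != 0 :> C by rewrite subr_eq0 eqr_nat gtn_eqF.
  rewrite ji divfK // -sqrrN /shifted; congr (_ ^+ 2).
  rewrite -rmorphB -rmorphN; congr (_%:~R); lia.
rewrite -e mulfK // expf_neq0 //; apply/prodf_neq0 => j _; exact: fact_neq0.
Qed.

(** For [x = lambda_i - i] the arguments of 1 / Gamma are [(z - 1) - x + 1] and [(w + N) + x + 1],
    which accounts for the shifts by -1 and [N]. *)
Lemma P'E l (z z' w w' : C) :
  P' l (z, z', w, w') = zw_term z z' w w' (shifted l) / (\prod_(j < N) j`!%:R) ^+ 2.
Proof.
rewrite /P' Dim_sqr /zw_term mulrAC; congr (_ * _ / _); apply: eq_bigr => i _.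
rewrite /hterm /shifted rmorphB /=; congr (invGamma _ * invGamma _ * invGamma _ * invGamma _);
  rewrite -[i.+1%:R in LHS]/(i.+1%:Z%:~R); ring.
Qed.

Lemma cvg_sumC (I : Type) (r : seq I) (P : pred I) (f : I -> nat -> C) (g : I -> C) :
  (forall i, P i -> f i n @[n --> \oo] --> g i) ->
  \sum_(i <- r | P i) f i n @[n --> \oo] --> \sum_(i <- r | P i) g i.
Proof.
move=> h; elim: r => [|i r IH].
  by under eq_fun do rewrite big_nil; rewrite big_nil; exact: cvg_cst.
under eq_fun do rewrite big_cons; rewrite big_cons.
case Pi: (P i); last exact: IH.
by apply: cvgD; [exact: h | exact: IH].
Qed.

Lemma cvg_prodC (I : Type) (r : seq I) (P : pred I) (f : I -> nat -> C) (g : I -> C) :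
  (forall i, P i -> f i n @[n --> \oo] --> g i) ->
  \prod_(i <- r | P i) f i n @[n --> \oo] --> \prod_(i <- r | P i) g i.
Proof.
move=> h; elim: r => [|i r IH].
  by under eq_fun do rewrite big_nil; rewrite big_nil; exact: cvg_cst.
under eq_fun do rewrite big_cons; rewrite big_cons.
case Pi: (P i); last exact: IH.
by apply: cvgM; [exact: h | exact: IH].
Qed.

Lemma cvg_gt_box (z z' w w' : C) : -1 < complex.Re (z + z' + w + w') ->
  \sum_(l <- gt_box B) P' l (z, z', w, w') @[B --> \oo] --> S_ N (z, z', w, w').
Proof.
move=> a1; pose D : C := (\prod_(j < N) j`!%:R) ^+ 2.
have D0 : D != 0 by rewrite expf_neq0 //; apply/prodf_neq0 => j _; exact: fact_neq0.
have -> : S_ N (z, z', w, w') = \det (moment_matrix N z z' w w' (@hsum R)) * D^-1.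
  by rewrite det_moment_matrix // mulfK.
have h : (fun B => \det (moment_matrix N z z' w w' (fun a b c d => bsum (hterm a b c d) B)) * D^-1)
    @ \oo --> \det (moment_matrix N z z' w w' (@hsum R)) * D^-1.
  apply: cvgM; last exact: cvg_cst.
  apply: cvg_sumC => s _; apply: cvgM; first exact: cvg_cst.
  apply: cvg_prodC => i _; rewrite !mxE; under eq_fun do rewrite mxE.
  apply: cvg_hsum.
  (* The parameters of the entry in row [i] and column [j] add up to [z + z' + w + w' + (N - 1 - i)
     + (N - 1 - j)], so the real part does not drop below that of the original sum. *)
  have i0 : (i.+1%:R : R) <= N%:R by rewrite ler_nat.
  have s0 : ((s i).+1%:R : R) <= N%:R by rewrite ler_nat.
  move: a1 i0 s0; rewrite -!natr1 !ReD !ReN !Re1 !Re_nat; lra.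
apply: cvg_trans h; apply: near_eq_cvg; apply: nearW => B.
rewrite -sum_zw_term_box sum_gt_box mulr_suml; apply: eq_bigr => g dg.
by rewrite P'E shifted_gt_of.
Qed.

Lemma prod_pairs (a : 'I_N -> R) :
  \prod_(i < N) \prod_(j < N | (i < j)%N) (a i * a j) = \prod_i a i ^+ N.-1.
Proof.
under [LHS]eq_bigr => i _ do rewrite big_split /=.
rewrite big_split /= [X in _ * X](exchange_big_dep xpredT) //= -big_split /=.
apply: eq_bigr => i _.
transitivity (\prod_(j < N | j != i) a i); last first.
  by rewrite prodr_const cardC1 card_ord.
rewrite [RHS](bigID (fun j : 'I_N => (i < j)%N)) /=; congr (_ * _).
  by apply: eq_bigl => j; rewrite -val_eqE /= neq_ltn; case: ltngtP.
by apply: eq_bigl => j; rewrite -val_eqE /= neq_ltn; case: ltngtP.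
Qed.

(** Each difference satisfies [|x_j - x_i| <= (|x_i| + 1) (|x_j| + 1)], and each index occurs in
    [N - 1] pairs. *)
Lemma nrm_vdm_le (x : 'I_N -> int) :
  nrm (vdm R x) ^+ 2 <= \prod_i (`|x i|.+1%:R : R) ^+ (2 * N.-1)%N.
Proof.
under [leRHS]eq_bigr do rewrite mulnC exprM.
rewrite prodrXl lerXn2r ?nnegrE ?nrm_ge0 //.
  by apply: prodr_ge0 => i _; rewrite exprn_ge0.
rewrite -prod_pairs /vdm nrm_prod; apply: ler_prod => i _.
rewrite nrm_ge0 /= nrm_prod; apply: ler_prod => j _.
rewrite nrm_ge0 /= -rmorphB nrm_int -natrM -intr_norm -natr_absz ler_nat /=.
by nia.
Qed.

End GelfandTsetlinBoxes.

(** * Domination and uniform convergence on compact sets *)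

Section UniformConvergence.
Variable R : realType.
Local Notation C := (Cplx R).
Implicit Types (e x : R).

(** The shifted [hterm] decays with exponent [- Re a - 2N], where [a = z + z' + w + w'], and the
    Vandermonde factor uses up [2 (N - 1)]; the rest, [- Re a - 2], is at most [- 1 - e]. *)
Lemma nrm_P'_le N (M : nat) e : (0 < N)%N -> exists2 c : R, 0 <= c &
  forall (l : GT N) (z z' w w' : C),
    nrm z <= M%:R -> nrm z' <= M%:R -> nrm w <= M%:R -> nrm w' <= M%:R ->
    e - 1 <= complex.Re (z + z' + w + w') ->
    nrm (P' l (z, z', w, w')) <= \prod_i (c * zweight (- 1 - e) (shifted l i)).
Proof.
move=> N0; have [c c0 hc] := @hterm_bounded R (M + N).
exists c => // l z z' w w' h1 h2 h3 h4 ha.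
have pred (u : C) : nrm u <= M%:R -> nrm (u - 1) <= (M + N)%:R.
  move=> h; rewrite (le_trans (nrmD _ _)) // nrmN nrm1 natrD lerD //.
  by rewrite ler1n.
have plus (u : C) : nrm u <= M%:R -> nrm (u + N%:R) <= (M + N)%:R.
  by move=> h; rewrite (le_trans (nrmD _ _)) // nrm_nat natrD lerD2r.
have b k : nrm (hterm (z - 1) (z' - 1) (w + N%:R) (w' + N%:R) k)
    <= c * (zweight (- 1 - e) k / (`|k|%N.+1)%:R ^+ (2 * N.-1)%N).
  apply: le_trans (hc k _ _ _ _ (pred _ h1) (pred _ h2) (plus _ h3) (plus _ h4)) _.
  rewrite ler_wpM2l // /zweight -powR_mulrn // -powRN -powRD ?pnatr_eq0 ?implybT //.
  apply: ler_powR; first by rewrite ler1n.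
  have -> : (2 * N.-1)%:R = 2 * N%:R - 2 :> R.
    by rewrite natrM -subn1 natrB // mulrBr mulr1.
  by move: ha; rewrite !ReD !ReN !Re1 !Re_nat; lra.
have d1 : 1 <= (\prod_(j < N) j`!%:R : R) ^+ 2.
  by rewrite exprn_ege1 // -natr_prod ler1n prodn_gt0 // => j; rewrite fact_gt0.
have dE : nrm ((\prod_(j < N) j`!%:R : C) ^+ 2) = (\prod_(j < N) j`!%:R : R) ^+ 2.
  by rewrite nrmX nrm_prod; congr (_ ^+ 2); apply: eq_bigr => j _; rewrite nrm_nat.
rewrite P'E nrmM nrmV dE ler_pdivrMr ?(lt_le_trans ltr01) //.
rewrite /zw_term nrmM nrmX nrm_prod.
have hp : \prod_i nrm (hterm (z - 1) (z' - 1) (w + N%:R) (w' + N%:R) (shifted l i)) <=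
    \prod_i (c * (zweight (- 1 - e) (shifted l i) / (`|shifted l i|%N.+1)%:R ^+ (2 * N.-1)%N)).
  by apply: ler_prod => i _; rewrite nrm_ge0 b.
have p0 : 0 <= \prod_(i < N) (c * zweight (- 1 - e) (shifted l i)).
  by apply: prodr_ge0 => i _; rewrite mulr_ge0 // zweight_ge0.
apply: le_trans (ler_pM _ _ (nrm_vdm_le _ (shifted l)) hp) _.
- by rewrite exprn_ge0 ?nrm_ge0.
- by apply: prodr_ge0 => i _; exact: nrm_ge0.
rewrite -big_split /= [leLHS](_ : _ = \prod_(i < N) (c * zweight (- 1 - e) (shifted l i))).
  by rewrite ler_peMr.
apply: eq_bigr => i _; rewrite mulrCA; congr (_ * _); rewrite mulrCA mulfV ?mulr1 //.
Qed.

Lemma compact_domD_bounds (K : set (Cplx4 R)) : compact K -> K `<=` domD R ->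
  exists M : nat, exists2 e : R, 0 < e & forall z z' w w' : C, K (z, z', w, w') ->
    [/\ nrm z <= M%:R, nrm z' <= M%:R, nrm w <= M%:R, nrm w' <= M%:R &
        e - 1 <= complex.Re (z + z' + w + w')].
Proof.
move=> cK KD.
have [-> | K0] := eqVneq K set0; first by exists 0%N; exists 1.
have {}K0 : K !=set0 by apply/set0P.
pose f (p : C * C * C * C) : R := nrm p.1.1.1 + nrm p.1.1.2 + nrm p.1.2 + nrm p.2.
pose g (p : C * C * C * C) : R := complex.Re (p.1.1.1 + p.1.1.2 + p.1.2 + p.2).
have c1 : continuous (fun p : C * C * C * C => p.1.1.1).
  move=> p; apply: (@cvg_comp _ _ _ (fun p : C * C * C * C => p.1) (fun q : C * C * C => q.1.1)).
    exact: cvg_fst.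
  by apply: (@cvg_comp _ _ _ (fun q : C * C * C => q.1) (fun q : C * C => q.1)); exact: cvg_fst.
have c2 : continuous (fun p : C * C * C * C => p.1.1.2).
  move=> p; apply: (@cvg_comp _ _ _ (fun p : C * C * C * C => p.1) (fun q : C * C * C => q.1.2)).
    exact: cvg_fst.
  apply: (@cvg_comp _ _ _ (fun q : C * C * C => q.1) (fun q : C * C => q.2)).
    exact: cvg_fst.
  exact: cvg_snd.
have c3 : continuous (fun p : C * C * C * C => p.1.2).
  move=> p; apply: (@cvg_comp _ _ _ (fun p : C * C * C * C => p.1) (fun q : C * C * C => q.2)).
    exact: cvg_fst.
  exact: cvg_snd.
have c4 : continuous (fun p : C * C * C * C => p.2) by move=> p; exact: cvg_snd.
have cf : continuous f.
  move=> p; apply: cvgD; last exact: (cvg_nrm (c4 p)).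
  apply: cvgD; last exact: (cvg_nrm (c3 p)).
  by apply: cvgD; [exact: (cvg_nrm (c1 p)) | exact: (cvg_nrm (c2 p))].
have cg : continuous g.
  move=> p; apply: cvg_Re; apply: cvgD; last exact: (c4 p).
  apply: cvgD; last exact: (c3 p).
  by apply: cvgD; [exact: (c1 p) | exact: (c2 p)].
have [p _ hp] := @compact_EVT_max _ _ f K K0 cK (continuous_subspaceT cf).
have [q qK hq] := @compact_EVT_min _ _ g K K0 cK (continuous_subspaceT cg).
have fp0 : 0 <= f p by rewrite /f !addr_ge0 ?nrm_ge0.
have fM := ltW (archi_boundP fp0); set M := Num.bound _ in fM.
(* The real part attains its minimum over [K] at a point [q] of [K], hence of the domain, so the gap
   [g q + 1] is positive. *)
exists M; exists (g q + 1).
  move: qK => /set_mem/KD; case: q {hq} => [[[z z'] w] w'].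
  by rewrite /domD /g /=; lra.
move=> z z' w w' Kp; have /hp hf := mem_set Kp; have /hq hg := mem_set Kp.
have := nrm_ge0 z; have := nrm_ge0 z'; have := nrm_ge0 w; have := nrm_ge0 w'.
rewrite /f /= in hf fM *; rewrite /g /= in hg.
by split; lra.
Qed.

Lemma P'_sum_uniform N (K : set (Cplx4 R)) (e : R) : (0 < N)%N -> compact K ->
  K `<=` domD R -> 0 < e ->
  exists A0 : {fset GT N}, forall A : {fset GT N}, (A0 `<=` A)%fset ->
    forall p, K p -> nrm (S_ N p - partial_sum (fun l => P' l p) A) < e.
Proof.
move=> N0 cK KD e0; have [M [d d0 hK]] := compact_domD_bounds cK KD.
have [c c0 hc] := nrm_P'_le M d N0.
pose h (l : GT N) : R := \prod_i (c * zweight (- 1 - d) (shifted l i)).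
have h0 l : 0 <= h l by apply: prodr_ge0 => i _; rewrite mulr_ge0 // zweight_ge0.
have hH (A : {fset GT N}) : \sum_(l <- A) h l <= (c * (1 + 2 / d)) ^+ N.
  apply: (sum_prod_gt_le A (c := fun k => c * zweight (- 1 - d) k)) => [k|B].
    by rewrite mulr_ge0 // zweight_ge0.
  by rewrite bsumM ler_wpM2l // bsum_zweight_le.
have [A0 hA0] := sum_fset_tail h0 hH (divr_gt0 e0 (ltr0n R 2)).
exists A0 => A A0A [[[z z'] w] w'] Kp.
have [b1 b2 b3 b4 a1] := hK _ _ _ _ Kp.
have a1' : -1 < complex.Re (z + z' + w + w') by lra.
(* The index [m] depends on the point, which is harmless: the box [X] is auxiliary, and the sum of
   the majorant over its part outside [A] is below [e / 2] whatever [X] is. *)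
have := @cvg_gt_box N R _ _ _ _ a1' => /cvg_nrmP/cvgr0Pnorm_lt/(_ _ (divr_gt0 e0 (ltr0n R 2)))[m _ hm].
have [B AB] := gt_box_cofinal A.
have {}hm : nrm (\sum_(l <- gt_box N (maxn m B)) P' l (z, z', w, w') - S_ N (z, z', w, w')) < e / 2.
  by rewrite -[ltLHS]ger0_norm ?nrm_ge0 //; exact: hm (leq_maxl _ _).
have {}AB := fsubset_trans AB (gt_box_mono N (leq_maxr m B)).
move: (gt_box N (maxn m B)) AB hm => X AX hm.
rewrite partial_sumE.
rewrite -[S_ N _](subrK (\sum_(l <- X) P' l (z, z', w, w'))) -addrA.
apply: le_lt_trans (nrmD _ _) _; rewrite nrmB [ltRHS](splitr e) ltrD //.
apply: le_lt_trans (hA0 A X A0A).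
rewrite (sum_fsubset _ AX) addrAC subrr add0r (sum_fsubset _ AX) addrAC subrr add0r.
apply: le_trans (nrm_sum _ _ _) _; apply: ler_sum => l _.
exact: hc.
Qed.

End UniformConvergence.

Unset Implicit Arguments.

Theorem proposition7p5 (R : realType) (N : nat) (hN : (0 < N)%N)
    (K : set (Cplx4 R)) :
  compact K -> K `<=` domD R ->
  {uniform K,
     (fun (A : {fset GT N}) p => partial_sum (fun l => P' l p) A) @ totally
     --> S_ N}.
Proof.
move=> cK KD P /uniform_nbhs[E [entE hE]].
(* The radius of the ball is an element [a + i b] of [Cplx R]; its positivity means [b = 0] and
   [0 < a], so [a] is a real tolerance. *)
move: entE; rewrite -entourage_ballE => -[[a b] /=]; rewrite ltcE /= => /andP[/eqP b0 a0] hb.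
have [A0 hA0] := P'_sum_uniform hN cK KD a0.
exists A0 => // A A0A; apply: hE => p Kp; apply: hb.
rewrite /ball /= /ball_ normE ltcE /= b0 eqxx /=.
exact: hA0.
Qed.
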